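(* Let $p>3$ be a prime, let $b,c\in\mathbb{Q}$, and assume $h(x)=x^{2p}+bx^p+c^p\in\mathbb{Q}[x]$ is irreducible over $\mathbb{Q}$. Let $d_h(x)=D_p(x,c)+b$. Then $d_h$ is irreducible over $\mathbb{Q}$, and the Galois groups over $\mathbb{Q}$ of $d_h$ and $h$ are as follows: (1) If $b^2-4c^p\notin(-1)^{p(p-1)/2}p\,\mathbb{Q}^2$, the Galois group of $d_h$ is $\mathrm{Aff}(\mathbb{F}_p)\simeq C_p\rtimes C_{p-1}$ and the Galois group of $h$ is $\mathrm{Aff}(\mathbb{F}_p)\times C_2$. (2) If $p\equiv 1\pmod 4$ and $b^2-4c^p\in p\,\mathbb{Q}^2$, the Galois groups of $d_h$ and of $h$ are both $\mathrm{Aff}(\mathbb{F}_p)$. (3) If $p\equiv 3\pmod 4$ and $b^2-4c^p\in -p\,\mathbb{Q}^2$, the Galois group of $d_h$ is $C_p\rtimes C_{(p-1)/2}$ (the index-$2$ normal subgroup of $\mathrm{Aff}(\mathbb{F}_p)$) and the Galois group of $h$ is $(C_p\rtimes C_{(p-1)/2})\times C_2$.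
   Context: The Dickson polynomials of the first kind are defined by $D_1(t,n)=t$, $D_2(t,n)=t^2-2n$, $D_k(t,n)=tD_{k-1}(t,n)-nD_{k-2}(t,n)$ for $k>2$. $\mathrm{Aff}(\mathbb{F}_p)$ is the group of affine maps $x\mapsto ax+e$ of $\mathbb{F}_p$ with $a\in\mathbb{F}_p^\times$, $e\in\mathbb{F}_p$; $C_p\rtimes C_{(p-1)/2}$ denotes its subgroup of maps with $a$ a nonzero square in $\mathbb{F}_p$. $\mathbb{Q}^2$ denotes the set of squares of rationals, and $k\mathbb{Q}^2=\{kq^2: q\in\mathbb{Q}\}$. *)

(* Defs.v *)
From HB Require Import structures.
From mathcomp Require Import all_boot all_order all_algebra all_fingroup.
From mathcomp Require Import all_solvable all_field.

Set Implicit Arguments.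
Unset Strict Implicit.
Unset Printing Implicit Defensive.

Import Order.TTheory GRing.Theory Num.Theory.
Local Open Scope ring_scope.

(* D_0 = 2 is the usual convention; the recurrence for k > 2 never reaches it. *)
Fixpoint dickson (R : comNzRingType) (n : R) (k : nat) {struct k} : {poly R} :=
  match k with
  | 0 => 2%:R%:P
  | 1 => 'X
  | 2 => 'X^2 - (2%:R * n)%:P
  | (k2.+1 as k1).+1 => 'X * dickson n k1 - n%:P * dickson n k2
  end.

Definition h_poly (p : nat) (b c : rat) : {poly rat} :=
  'X^(2 * p) + b%:P * 'X^p + (c ^+ p)%:P.

Definition d_poly (p : nat) (b c : rat) : {poly rat} := dickson c p + b%:P.

Definition in_rat_sq_class (k x : rat) : Prop := exists q : rat, x = k * q ^+ 2.

(* The Galois group of f over Q, up to isomorphism: Gal(L / Q) for any splitting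
   field L of f over Q. Such an L exists, see rat_splitting_field_exists. *)
Definition galois_group_isog (f : {poly rat}) (gT : finGroupType)
    (G : {group gT}) : Prop :=
  forall L : splittingFieldType rat,
    splittingFieldFor 1 (map_poly (in_alg L) f) {:L} ->
    'Gal({:L} / 1) \isog G.

Lemma rat_splitting_field_exists (f : {poly rat}) : f != 0 ->
  exists L : splittingFieldType rat,
    splittingFieldFor 1 (map_poly (in_alg L) f) {:L}.
Proof.
move=> nzf; have [rs Drs] := closed_field_poly_normal (map_poly ratr f : {poly algC}).
have [Qs [QsC [s1 Ds1 genQs]]] := num_field_exists rs.
have eqf : map_poly (in_alg Qs) f %= \prod_(z <- s1) ('X - z%:P).
  rewrite -(eqp_map QsC) -map_poly_comp.
  rewrite (@eq_map_poly _ _ _ (ratr : rat -> algC)) => [|a] /=; last first.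
    by rewrite alg_num_field fmorph_rat.
  rewrite Drs; have -> : map_poly QsC (\prod_(z <- s1) ('X - z%:P)) =
      \prod_(z <- rs) ('X - z%:P).
    rewrite rmorph_prod /= -Ds1 big_map; apply: eq_bigr => z _.
    by rewrite rmorphB /= map_polyX map_polyC.
  by rewrite eqp_scale // lead_coef_eq0 map_poly_eq0.
have splQs : splittingFieldFor 1 (map_poly (in_alg Qs) f) {:Qs} by exists s1.
have axQs : SplittingField.axiom Qs.
  by exists (map_poly (in_alg Qs) f) => //; apply/polyOver1P; exists f.
pose mix := FieldExt_isSplittingField.Build rat Qs axQs.
by exists (HB.pack_for (splittingFieldType rat) Qs mix).
Qed.

Section AffineGroup.

Variable p : nat.
Implicit Types s t : {perm 'F_p}.

Definition affine_map s (a e : 'F_p) : bool := [forall x, s x == a * x + e].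

Definition Aff : {set {perm 'F_p}} :=
  [set s | [exists a : 'F_p, exists e : 'F_p, (a != 0) && affine_map s a e]].

Definition AffSq : {set {perm 'F_p}} :=
  [set s | [exists a : 'F_p, exists e : 'F_p,
     [&& a != 0, [exists u : 'F_p, a == u ^+ 2] & affine_map s a e]]].

Lemma AffP s :
  reflect (exists a e, a != 0 /\ forall x, s x = a * x + e) (s \in Aff).
Proof.
rewrite inE; apply: (iffP existsP) => [[a /existsP[e /andP[a0 /forallP H]]]|].
  by exists a, e; split=> // x; apply/eqP.
case=> a [e [a0 H]]; exists a; apply/existsP; exists e; rewrite a0.
by apply/forallP=> x; rewrite H.
Qed.

Lemma AffSqP s :
  reflect (exists u e, u != 0 /\ forall x, s x = u ^+ 2 * x + e) (s \in AffSq).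
Proof.
rewrite inE; apply: (iffP existsP).
  case=> a /existsP[e /and3P[a0 /existsP[u /eqP au] /forallP H]].
  exists u, e; split=> [|x]; last by rewrite -au; apply/eqP.
  by apply: contraNneq a0 => u0; rewrite au u0 expr0n.
case=> u [e [u0 H]]; exists (u ^+ 2); apply/existsP; exists e.
rewrite expf_neq0 //=; apply/andP; split; first by apply/existsP; exists u.
by apply/forallP=> x; rewrite H.
Qed.

Lemma Aff_group_set : group_set Aff.
Proof.
apply/group_setP; split=> [|s t /AffP[a [e [a0 Hs]]] /AffP[a' [e' [a0' Ht]]]].
  by apply/AffP; exists 1, 0; split=> [|x]; rewrite ?oner_eq0 // perm1 mul1r addr0.
apply/AffP; exists (a' * a), (a' * e + e'); split=> [|x]; first by rewrite mulf_neq0.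
by rewrite permM Hs Ht mulrDr mulrA addrA.
Qed.
Canonical Aff_group := Group Aff_group_set.

Lemma AffSq_group_set : group_set AffSq.
Proof.
apply/group_setP; split=> [|s t /AffSqP[a [e [a0 Hs]]] /AffSqP[a' [e' [a0' Ht]]]].
  apply/AffSqP; exists 1, 0; split=> [|x]; rewrite ?oner_eq0 //.
  by rewrite perm1 expr1n mul1r addr0.
apply/AffSqP; exists (a' * a), (a' ^+ 2 * e + e').
split=> [|x]; first by rewrite mulf_neq0.
by rewrite permM Hs Ht exprMn mulrDr mulrA addrA.
Qed.
Canonical AffSq_group := Group AffSq_group_set.

End AffineGroup.

(* G = K ><| H with K, H cyclic of orders m and n and H acting faithfully on K. *)
Definition is_cyclic_sdprod (gT : finGroupType) (G : {group gT}) (m n : nat) :=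
  exists K H : {group gT},
    [/\ K ><| H = G, cyclic K /\ #|K| = m, cyclic H /\ #|H| = n
      & 'C_H(K) = 1]%g.

Section AffineStructure.

Variable p : nat.
Hypothesis p_pr : prime p.

Definition tr_perm (e : 'F_p) : {perm 'F_p} := perm (@addIr _ e).
Definition mu_perm (u : {unit 'F_p}) : {perm 'F_p} := perm (mulrI (valP u)).

Lemma tr_permM : {in [set: 'F_p] &, {morph tr_perm : x y / (x * y)%g}}.
Proof. by move=> x y _ _; apply/permP=> z; rewrite permM !permE /= addrA. Qed.
Canonical tr_morphism := Morphism tr_permM.

Lemma mu_permM : {in [set: {unit 'F_p}] &, {morph mu_perm : x y / (x * y)%g}}.
Proof.
move=> x y _ _; apply/permP=> z; rewrite permM !permE /=.
by rewrite mulrA [_ y * _]mulrC.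
Qed.
Canonical mu_morphism := Morphism mu_permM.

Lemma sq_unitM :
  {in [set: {unit 'F_p}] &, {morph (fun u => u ^+ 2)%g : x y / (x * y)%g}}.
Proof.
move=> x y _ _; apply: expgMn; apply: val_inj; exact: mulrC.
Qed.
Canonical sq_morphism := Morphism sq_unitM.

Lemma injm_tr : ('injm tr_perm)%g.
Proof.
apply/injmP=> x y _ _ /permP/(_ 0); rewrite !permE /= => H; apply: (addrI 0).
exact: H.
Qed.

Lemma injm_mu : ('injm mu_perm)%g.
Proof.
apply/injmP=> x y _ _ /permP/(_ 1); rewrite !permE /= !mulr1; exact: val_inj.
Qed.

Lemma aff_sdprod (G : {group {perm 'F_p}}) (U : {group {unit 'F_p}}) :
    (forall s, s \in G <-> exists2 u, u \in U &
       exists e, forall x, s x = FinRing.uval u * x + e) ->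
  is_cyclic_sdprod G p #|U|.
Proof.
move=> GP; exists (tr_morphism @* setT)%G, (mu_morphism @* U)%G => /=.
have cardK : #|(tr_morphism @* setT)%g| = p.
  by rewrite card_injm ?injm_tr ?subsetT // cardsT card_Fp.
have KP s : reflect (exists e, s = tr_perm e) (s \in tr_morphism @* setT)%g.
  apply: (iffP morphimP) => [[e _ _ ->]|[e ->]]; first by exists e.
  by exists e; rewrite ?inE.
have HP s : reflect (exists2 u, u \in U & s = mu_perm u) (s \in mu_morphism @* U)%g.
  apply: (iffP morphimP) => [[u _ Uu ->]|[u Uu ->]]; first by exists u.
  by exists u; rewrite ?inE.
have KH (u : {unit 'F_p}) e (s : {perm 'F_p}) : (forall x, s x = FinRing.uval u * x + e) ->
    s = (mu_perm u * tr_perm e)%g.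
  by move=> Hs; apply/permP=> x; rewrite permM !permE Hs.
have mulHK : (mu_morphism @* U * tr_morphism @* setT = G)%g.
  apply/setP=> s; apply/mulsgP/idP => [[h k /HP[u Uu ->] /KP[e ->] ->]|].
    by apply/GP; exists u => //; exists e => x; rewrite permM !permE.
  move=> /GP[u Uu [e /KH Ds]]; exists (mu_perm u) (tr_perm e) => //.
    by apply/HP; exists u.
  by apply/KP; exists e.
have nKH : (mu_morphism @* U \subset 'N(tr_morphism @* setT))%g.
  apply/subsetP=> h /HP[u Uu ->]; rewrite inE; apply/subsetP=> _ /imsetP[k /KP[e ->] ->].
  apply/KP; exists (FinRing.uval u * e); apply: (mulgI (mu_perm u)).
  by rewrite -conjgC; apply/permP=> x; rewrite !permM !permE /= mulrDr.
split.
- rewrite sdprodE //.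
    by rewrite -mulHK (normC nKH).
  apply/eqP; rewrite -subG1; apply/subsetP=> s /setIP[/KP[e ->] /HP[u _ E]].
  have e0 : e = 0 by have /permP/(_ 0) := E; rewrite !permE /= add0r mulr0.
  by rewrite e0; apply/set1P/permP=> x; rewrite !permE addr0.
- by split=> //; apply: prime_cyclic; rewrite cardK.
- split; last by rewrite card_injm ?injm_mu ?subsetT.
  by apply: morphim_cyclic; apply: field_unit_group_cyclic.
- apply/eqP; rewrite -subG1; apply/subsetP=> s /setIP[/HP[u _ ->] /centP cu].
  have /cu/permP/(_ 0) : tr_perm 1 \in (tr_morphism @* setT)%g by apply/KP; exists 1.
  rewrite !permM !permE /= mulr0 !add0r mulr1 => u1.
  by apply/set1P/permP=> x; rewrite !permE /= -u1 mul1r.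
Qed.

Lemma card_unit_Fp : #|[set: {unit 'F_p}]| = p.-1.
Proof. by rewrite card_finField_unit card_Fp. Qed.

Lemma card_sq_unit_Fp : odd p -> #|(sq_morphism @* setT)%g| = (p.-1 %/ 2)%N.
Proof.
move=> op; rewrite card_morphim setTI -divgS ?subsetT //= card_unit_Fp; congr (_ %/ _)%N.
have -> : #|('ker sq_morphism)%g| = 2%N.
  have N1 : (-1 : 'F_p) \is a GRing.unit by rewrite unitrN unitr1.
  have vE (u v : {unit 'F_p}) : (u == v) = (FinRing.uval u == FinRing.uval v) by [].
  have -> : ('ker sq_morphism)%g = [set 1%g; FinRing.unit 'F_p N1].
    apply/setP=> u; rewrite !inE !vE; exact: sqrf_eq1.
  rewrite cards2 vE [FinRing.uval 1%g]/= [FinRing.uval _]/= -subr_eq0 opprK.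
  have -> : (1 + 1 : 'F_p) = 2%:R by [].
  suff -> : (2%:R : 'F_p) != 0 by [].
  rewrite -(dvdn_pcharf (pchar_Fp p_pr)); apply: contraL op => /dvdn_leq/= p2.
  by case: p p_pr (p2 isT) => [|[|[|]]].
by [].
Qed.

Lemma Aff_sdprod : is_cyclic_sdprod (Aff_group p) p p.-1.
Proof.
rewrite -card_unit_Fp; apply: aff_sdprod => s.
split=> [/AffP[a [e [a0 Hs]]]|[u _ [e Hs]]].
  have ua : a \is a GRing.unit by rewrite unitfE.
  by exists (FinRing.unit 'F_p ua); rewrite ?inE //; exists e.
by apply/AffP; exists (FinRing.uval u), e; rewrite -unitfE; split=> //; exact: valP.
Qed.

Lemma AffSq_sdprod : odd p -> is_cyclic_sdprod (AffSq_group p) p (p.-1 %/ 2).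
Proof.
move=> op; rewrite -card_sq_unit_Fp //; apply: aff_sdprod => s.
split=> [/AffSqP[a [e [a0 Hs]]]|[u /morphimP[v _ _ ->] [e Hs]]].
  have ua : a \is a GRing.unit by rewrite unitfE.
  exists (FinRing.unit 'F_p ua ^+ 2)%g; last by exists e.
  by apply/morphimP; exists (FinRing.unit 'F_p ua); rewrite ?inE.
apply/AffSqP; exists (FinRing.uval v), e; rewrite -unitfE; split=> //; exact: valP.
Qed.

Lemma AffSq_normal_index2 :
  odd p -> (AffSq p <| Aff p)%g /\ #|Aff p : AffSq p|%g = 2%N.
Proof.
move=> op.
have sub : AffSq p \subset Aff p.
  apply/subsetP=> s /AffSqP[u [e [u0 H]]].
  by apply/AffP; exists (u ^+ 2), e; rewrite expf_neq0.
suff idx : #|Aff p : AffSq p|%g = 2%N.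
  by split=> //; apply: (@index2_normal _ (Aff_group p) (AffSq_group p)).
have [K [H [/sdprod_card oA [_ oK] [_ oH] _]]] := Aff_sdprod.
have [K' [H' [/sdprod_card oS [_ oK'] [_ oH'] _]]] := AffSq_sdprod op.
rewrite -divgS //= -oA -oS oK oH oK' oH' divnMl ?prime_gt0 //.
have p1 := prime_gt1 p_pr.
have E : (p.-1 %/ 2 * 2 = p.-1)%N.
  by rewrite divnK // dvdn2 -subn1 oddB ?op // ltnW.
have k0 : (0 < p.-1 %/ 2)%N.
  by rewrite divn_gt0 //; case: p op p1 => [|[|[|]]].
by rewrite -{1}E mulKn.
Qed.

End AffineStructure.

(* Main.v *)
Require Import Defs.
From HB Require Import structures.
From mathcomp Require Import all_boot all_order all_algebra all_fingroup.
From mathcomp Require Import all_solvable all_field.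
From mathcomp Require Import zify ring.

(**
Let [a] be a root of [h] and [z] a primitive [p]-th root of unity. The roots of
[h] are the [z^i a] and [z^i a'] with [a' = c / a], and those of [d_h] are the
[T j = z^j a + z^(-j) a'], for [i], [j] in [F_p]. An automorphism mapping [z] to
[z^k] and [a] to [z^i a] (put [e = 1]) or to [z^i a'] (put [e = -1]) maps [T j]
to [T (e (k j + i))], and the square root [delta = a^p - a'^p] of [b^2 - 4 c^p]
to [e delta]. This embeds the Galois group of [h] in Aff(F_p) x C_2, and the
first projection is its action on the roots of [d_h].

The image is found by comparing orders. The degree of [Q(z, a)] is divisible by
[p - 1] and by [2 p], and also by [2 (p - 1)] when [delta] is not in [Q(z)].
Since the unit group of [F_p] is cyclic, [Q(z)] contains one quadratic field
only, which is generated by a square root of [p* = (-1)^((p-1)/2) p] obtained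
from [prod (1 - z^i) = p]; so [delta] is in [Q(z)] exactly when [b^2 - 4 c^p] is
in [p* Q^2], and then [e] is the quadratic character of [k].
*)

Set Implicit Arguments.
Unset Strict Implicit.
Unset Printing Implicit Defensive.

Import Order.TTheory GRing.Theory Num.Theory.
Local Open Scope group_scope.
Local Open Scope ring_scope.

(** * Galois theory over the rationals: minimal polynomials, conjugates, embeddings *)

Lemma galois_rat (M : splittingFieldType rat) (K : {subfield M}) :
  galois K {:M}.
Proof.
rewrite /galois subvf normalFieldf andbT; apply/separableP => x _.
by apply: pcharf0_separable => n; rewrite pchar_lalg pchar_num.
Qed.

Section RationalExtension.

Variable L : fieldExtType rat.

Lemma irreducible_minPoly (q : {poly rat}) (x : L) :
    irreducible_poly q -> q \is monic -> root (map_poly (in_alg L) q) x ->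
  minPoly 1 x = map_poly (in_alg L) q.
Proof.
move=> irr_q mon_q qx0; have /polyOver1P[r Dr] := minPolyOver 1 x.
have rq : r %| q.
  rewrite -(dvdp_map (in_alg L)) /= -Dr minPoly_dvdp //.
  by apply/polyOver1P; exists q.
have sr : size r != 1%N.
  by rewrite -(size_map_poly (in_alg L)) -Dr size_minPoly eqSS -lt0n.
have eq_rq := irr_q.2 _ sr rq; rewrite Dr; congr map_poly.
have mon_r : r \is monic by rewrite -(map_monic (in_alg L)) /= -Dr monic_minPoly.
by apply/eqP; rewrite -eqp_monic.
Qed.

(** Brings [minPoly] down to [{poly rat}], from where it can be mapped into any other extension of
    the rationals. *)
Lemma minPoly_irreducible (x : L) :
  exists m : {poly rat}, [/\ irreducible_poly m, m \is monic
    & minPoly 1 x = map_poly (in_alg L) m].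
Proof.
have /polyOver1P[r Dr] := minPolyOver 1 x; exists r.
split=> //; last by rewrite -(map_monic (in_alg L)) /= -Dr monic_minPoly.
split=> [|q sq qr].
  by rewrite -(size_map_poly (in_alg L)) -Dr size_minPoly ltnS.
have := @minPoly_irr _ _ 1%AS x (map_poly (in_alg L) q).
rewrite Dr dvdp_map qr eqp_map -size_poly_eq1 size_map_poly (negPf sq) orbF.
by apply=> //; apply/polyOver1P; exists q.
Qed.

Lemma dim_adjoin_irreducible (q : {poly rat}) (x : L) :
    irreducible_poly q -> q \is monic -> root (map_poly (in_alg L) q) x ->
  \dim <<1; x>> = (size q).-1.
Proof.
move=> irr_q mon_q qx0; rewrite -(size_map_poly (in_alg L)).
rewrite -(irreducible_minPoly irr_q mon_q qx0) size_minPoly adjoin_degreeE.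
by rewrite dimv1 divn1.
Qed.

End RationalExtension.

(** Being irreducible, [q] is associate to the minimal polynomial of [x], and [M] is normal. *)
Lemma gal_conj_root (M : splittingFieldType rat) (q : {poly rat}) (x y : M) :
    irreducible_poly q -> root (map_poly (in_alg M) q) x ->
    root (map_poly (in_alg M) q) y ->
  exists2 s, s \in 'Gal({:M} / 1) & s x = y.
Proof.
move=> irr_q qx0 qy0; have [m [irr_m mon_m Dm]] := minPoly_irreducible x.
have qm : m %= q.
  apply: irr_q.2; first by rewrite neq_ltn irr_m.1 orbT.
  rewrite -(dvdp_map (in_alg M)) /= -Dm minPoly_dvdp //.
  by apply/polyOver1P; exists q.
have my0 : root (minPoly 1 x) y.
  rewrite Dm (@eqp_root _ _ (map_poly (in_alg M) q)) //.
  by rewrite eqp_map.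
have [s Gs] :=
  normalField_root_minPoly (subvf 1%AS) (normalFieldf 1%AS) (memvf x) my0.
by exists s.
Qed.

Lemma gal_horner_rat (M : splittingFieldType rat) (s : gal_of {:M})
    (q : {poly rat}) (x : M) :
  s (map_poly (in_alg M) q).[x] = (map_poly (in_alg M) q).[s x].
Proof.
rewrite -horner_map -map_poly_comp; congr (_.[_]); apply: eq_map_poly => a /=.
by rewrite linearZ /= rmorph1.
Qed.

Lemma gal_root_rat (M : splittingFieldType rat) (s : gal_of {:M})
    (q : {poly rat}) (x : M) :
  root (map_poly (in_alg M) q) x -> root (map_poly (in_alg M) q) (s x).
Proof. by rewrite !rootE -gal_horner_rat => /eqP->; rewrite rmorph0. Qed.

Lemma mem1_gal (M : splittingFieldType rat) (x : M) :
    (forall s, s \in 'Gal({:M} / 1) -> s x = x) -> exists r : rat, x = r%:A.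
Proof.
move=> fx; apply/vlineP; rewrite -[<[1]>%VS]/(1%AS : {vspace M}).
have /galois_fixedField<- := galois_rat (1%AS : {subfield M}).
by apply/fixedFieldP; rewrite ?memvf.
Qed.

Lemma adjoin_full_horner (L : fieldExtType rat) (x z : L) :
  <<1; x>>%VS = {:L}%VS -> exists q, z = (map_poly (in_alg L) q).[x].
Proof.
move=> genL; have : z \in <<1; x>>%VS by rewrite genL memvf.
by case/Fadjoin_polyP=> q /polyOver1P[r ->] ->; exists r.
Qed.

(** Every element of [L] is [q.[x]] for a rational [q], and is sent to [q.[y]]. This does not depend
    on [q]: two choices differ by a multiple of [m], which vanishes at [y]. *)
Lemma number_field_embedding (L M : fieldExtType rat) (m : {poly rat}) (x : L)
    (y : M) :
    <<1; x>>%VS = {:L}%VS -> minPoly 1 x = map_poly (in_alg L) m ->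
    root (map_poly (in_alg M) m) y ->
  exists g : {rmorphism L -> M}, g x = y.
Proof.
move=> genL Dm my0.
have Lx z : exists q, z == (map_poly (in_alg L) q).[x].
  by have [q ->] := adjoin_full_horner z genL; exists q.
pose g z := (map_poly (in_alg M) (xchoose (Lx z))).[y].
(* Frees [g] from the representative picked by [xchoose]; the morphism laws are then those of
   polynomial evaluation. *)
have gE q : g (map_poly (in_alg L) q).[x] = (map_poly (in_alg M) q).[y].
  rewrite /g; set e := Lx _; move/eqP: (xchooseP e); move: (xchoose e) => r.
  move/eqP; rewrite -subr_eq0 -hornerN -hornerD -rmorphB -rootE => qr0.
  have : m %| q - r.
    rewrite -(dvdp_map (in_alg L)) /= -Dm minPoly_dvdp //.
    by apply/polyOver1P; exists (q - r).
  case/dvdpP=> w /(canRL (subrK _))->; rewrite rmorphD rmorphM hornerD hornerM /=.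
  by rewrite (rootP my0) mulr0 add0r.
have gB : zmod_morphism g.
  move=> u v; have [q /eqP->] := Lx u; have [r /eqP->] := Lx v.
  by rewrite -hornerN -hornerD -rmorphB !gE rmorphB hornerD hornerN.
have gM : monoid_morphism g.
  split=> [|u v].
    by have := gE 1; rewrite !rmorph1 !hornerC.
  have [q /eqP->] := Lx u; have [r /eqP->] := Lx v.
  by rewrite -hornerM -rmorphM !gE rmorphM hornerM.
pose gmix := GRing.isZmodMorphism.Build L M g gB.
pose gmix2 := GRing.isMonoidMorphism.Build L M g gM.
pose gr : {rmorphism L -> M} := HB.pack g gmix gmix2.
by exists gr; have := gE 'X; rewrite !map_polyX !hornerX.
Qed.

(** * Cyclotomic polynomials and primitive roots of unity *)

Lemma irreducible_Cyclotomic n :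
  (0 < n)%N -> irreducible_poly (map_poly (intr : int -> rat) 'Phi_n).
Proof.
move=> n_gt0; have [z prim_z] := C_prim_root_exists n_gt0.
have [q [Dq mon_q] dv_q] := minCpolyP z.
(* In [algC] both sides become the minimal polynomial of [z]. *)
have -> : map_poly (intr : int -> rat) 'Phi_n = q.
  apply: (map_inj_poly (@fmorph_inj _ _ (ratr : rat -> algC))).
    by rewrite rmorph0.
  rewrite -Dq (minCpoly_cyclotomic prim_z) -(Cintr_Cyclotomic prim_z).
  rewrite -map_poly_comp; apply: eq_map_poly => a /=.
  by rewrite ratr_int.
split=> [|r sr /dvdpP[s Ds]].
  by rewrite -(size_map_poly (ratr : {rmorphism rat -> algC})) /= -Dq size_minCpoly.
have : root (map_poly (ratr : rat -> algC) q) z by rewrite -Dq root_minCpoly.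
have q0 : q != 0 by rewrite monic_neq0.
have [s0 r0] : s != 0 /\ r != 0.
  by split; apply: contraNneq q0 => E; rewrite Ds E ?mulr0 ?mul0r.
(* [z] is a root of [s] or of [r], so [q] divides that factor. If it divides [r], the two are
   associate; if it divides [s], comparing sizes makes [r] constant. *)
rewrite {1}Ds rmorphM rootM !dv_q => /orP[qs|qr]; last first.
  by rewrite /eqp qr Ds dvdp_mull.
have := dvdp_leq s0 qs; rewrite Ds size_mul // -subn1 => le_s.
have : (size r <= 1)%N.
  by rewrite leq_subLR addnC leq_add2r in le_s.
by rewrite leq_eqVlt (negPf sr) ltnS leqn0 size_poly_eq0 (negPf r0).
Qed.

(** For prime [p], [X^p - 1] is [(X - 1) 'Phi_p], and [z] is not [1]. *)
Lemma root_Cyclotomic_prime (L : fieldExtType rat) p (z : L) :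
    prime p -> p.-primitive_root z ->
  root (map_poly (in_alg L) (map_poly (intr : int -> rat) 'Phi_p)) z.
Proof.
move=> p_pr prim_z; have p_gt0 := prime_gt0 p_pr.
have z_n1 : z != 1.
  by rewrite -[z]expr1 -(prim_order_dvd prim_z) dvdn1 neq_ltn prime_gt1 ?orbT.
have : \prod_(d <- [:: 1%N; p]) 'Phi_d = 'X^p - 1.
  rewrite -prod_Cyclotomic //; apply: perm_big; apply: uniq_perm => [||d].
  - by rewrite /= inE andbT neq_ltn prime_gt1.
  - exact: divisors_uniq.
  rewrite -dvdn_divisors // !inE; apply/idP/idP => [/pred2P[]-> //|].
  by case/primeP: p_pr => _ p_div /p_div.
have Phi1 : 'Phi_1 = 'X - 1 :> {poly int}.
  by have := @prod_Cyclotomic 1 isT; rewrite [divisors 1]/= big_seq1.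
rewrite big_cons big_seq1 Phi1.

move/(congr1 (fun q => map_poly (in_alg L) (map_poly (intr : int -> rat) q))).
rewrite !rmorphM !rmorphB !rmorph1 /= !map_polyXn !map_polyX => /(congr1 (horner^~ z)).
rewrite hornerM !hornerD !hornerN hornerC hornerX hornerXn.
rewrite (prim_expr_order prim_z) subrr => /eqP; rewrite mulf_eq0 subr_eq0.
by rewrite (negPf z_n1).
Qed.

Lemma dim_adjoin_prim_root (L : fieldExtType rat) p (z : L) :
  prime p -> p.-primitive_root z -> \dim <<1; z>> = p.-1.
Proof.
move=> p_pr prim_z; have p_gt0 := prime_gt0 p_pr.
rewrite (dim_adjoin_irreducible (irreducible_Cyclotomic p_gt0)).
- by rewrite size_map_inj_poly ?size_Cyclotomic ?totient_prime //; apply: intr_inj.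
- by rewrite monic_map ?Cyclotomic_monic.
- exact: root_Cyclotomic_prime.
Qed.

(** Cancel [X - 1] in the factorization of [X^n - 1] and evaluate the quotient
    [1 + X + ... + X^(n-1)] at [1]. *)
Lemma prod_1_sub_prim_root (F : fieldType) n (z : F) :
  n.-primitive_root z -> \prod_(1 <= i < n) (1 - z ^+ i) = n%:R.
Proof.
move=> prim_z; have n_gt0 := prim_order_gt0 prim_z.
have := factor_Xn_sub_1 prim_z; rewrite big_ltn // expr0 subrX1.
move/(mulfI (_ : 'X - 1%:P != 0)); rewrite polyXsubC_eq0 => /(_ isT).
move/(congr1 (horner^~ 1)); rewrite horner_prod horner_sum.
rewrite (eq_bigr (fun i => 1 - z ^+ i)) => [->|i _]; last by rewrite !hornerE.
rewrite (eq_bigr (fun=> 1)) => [|i _]; last by rewrite hornerXn expr1n.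
by rewrite sumr_const card_ord.
Qed.

(* Pairing [i] with [p - i] turns [prod (1 - z^i) = p] into a square up to
   sign, once [z] is written as the square of [w = z ^ ((p + 1) / 2)]. *)
Lemma sqrt_prime_prim_root (F : fieldType) m (z : F) :
    m.*2.+1.-primitive_root z ->
  (\prod_(1 <= i < m.+1) ((z ^+ m.+1) ^+ i - (z ^+ m.+1) ^- i)) ^+ 2
    = (-1) ^+ m * m.*2.+1%:R.
Proof.
move=> prim_z; rewrite -(prod_1_sub_prim_root prim_z).
have z0 : z != 0 by rewrite (prim_root_eq0 prim_z).
have w2 : (z ^+ m.+1) ^+ 2 = z.
  rewrite -exprM muln2 doubleS -[m.*2.+2]addn1 exprD expr1.
  by rewrite (prim_expr_order prim_z) mul1r.
move: (z ^+ m.+1) (expf_neq0 m.+1 z0) w2 => w w0 w2.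
rewrite [in RHS](@big_cat_nat _ _ _ m.+1) //=; last by lia.
(* The upper half of the product is reindexed by [i -> 2m + 1 - i], which turns [z^i] into
   [z^-i]. *)
have -> : \prod_(m.+1 <= i < m.*2.+1) (1 - z ^+ i) =
    \prod_(1 <= i < m.+1) (1 - z ^- i).
  rewrite big_nat_rev -{1}[m.+1]addn1 -{1}[m.*2.+1]addn1.
  rewrite -[X in \prod_(_ <= _ < X) _](@subnK m); last by lia.
  rewrite addnC big_addn; apply: congr_big_nat => // [|i]; first by lia.
  move=> Hi; congr (1 - _); apply: (mulfI (expf_neq0 i z0)).
  rewrite divff ?expf_neq0 // -exprD; apply/eqP; rewrite -(prim_order_dvd prim_z).
  by rewrite (_ : (_ + _)%N = m.*2.+1) ?dvdnn //; lia.
rewrite -big_split -prodrXl /=.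
have -> : (-1) ^+ m = \prod_(1 <= i < m.+1) (-1) :> F.
  by rewrite big_const_nat subn1 /= iter_mulr_1.
rewrite -big_split; apply: eq_bigr => i _ /=; rewrite -w2 exprAC.
by have wi0 := expf_neq0 i w0; field.
Qed.

(** * Exponents modulo [p] and squares in finite fields *)

Lemma ltn_Fp p (x : 'F_p) : prime p -> (x < p)%N.
Proof. by move=> p_pr; have := ltn_ord x; rewrite [X in (_ < X)%N](Fp_cast p_pr). Qed.

Section ExponentsModP.

Variables (p : nat) (F : fieldType) (z : F).
Hypotheses (p_pr : prime p) (prim_z : p.-primitive_root z).

(** An exponent in ['F_p] is read as its representative below [p], so the laws of exponents in this
    section rest on [z ^+ p = 1]. *)
Lemma exprFp_nat n : z ^+ (n%:R : 'F_p) = z ^+ n.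
Proof. by rewrite val_Fp_nat // (prim_expr_mod prim_z). Qed.

Lemma exprFpD (x y : 'F_p) : z ^+ (x + y)%R = z ^+ x * z ^+ y.
Proof. by rewrite -exprD -(exprFp_nat (x + y)%N) natrD !natr_Zp. Qed.

Lemma exprFpM (x y : 'F_p) : z ^+ (x * y)%R = (z ^+ x) ^+ y.
Proof. by rewrite -exprM -(exprFp_nat (x * y)%N) natrM !natr_Zp. Qed.

Lemma exprFpN (x : 'F_p) : z ^+ (- x)%R = (z ^+ x)^-1.
Proof.
have z0 : z != 0 by rewrite (prim_root_eq0 prim_z) -lt0n prime_gt0.
by apply: (mulfI (expf_neq0 x z0)); rewrite -exprFpD subrr expr0 divff ?expf_neq0.
Qed.

Lemma exprFp_inj : injective (fun x : 'F_p => z ^+ x).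
Proof.
move=> x y /eqP; rewrite (eq_prim_root_expr prim_z) => /eqP.
by rewrite !modn_small ?ltn_Fp // => xy; apply: val_inj.
Qed.

Lemma prim_rootFpP (x : F) : x ^+ p = 1 -> exists i : 'F_p, x = z ^+ i.
Proof.
by move/(prim_rootP prim_z) => [i ->]; exists i%:R; rewrite exprFp_nat.
Qed.

End ExponentsModP.

(** Nonsquares are odd powers of a generator of the cyclic unit group, and the sum of two odd
    exponents is even. *)
Lemma mul_nonsquare_finField (F : finFieldType) (x y : F) :
    ~~ [exists u, x == u ^+ 2] -> ~~ [exists u, y == u ^+ 2] ->
  [exists u, x * y == u ^+ 2].
Proof.
move=> nx ny.
have [x0 y0] : x != 0 /\ y != 0.
  by split; [apply: contraNneq nx | apply: contraNneq ny] => ->;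
    apply/existsP; exists 0; rewrite expr0n.
have /cyclicP[g Dg] := field_unit_group_cyclic [set: {unit F}].
have gen (a : F) : a != 0 -> exists n, a = (FinRing.uval g) ^+ n.
  rewrite -unitfE => ua; have : FinRing.unit F ua \in <[g]>%g by rewrite -Dg inE.
  by case/cycleP=> n /(congr1 FinRing.uval) /= ->; exists n; rewrite FinRing.val_unitX.
have sq n : ~~ odd n -> [exists u, FinRing.uval g ^+ n == u ^+ 2].
  move=> en; apply/existsP; exists (FinRing.uval g ^+ n./2).
  by rewrite -exprM muln2 even_halfK.
have [i Di] := gen _ x0; have [j Dj] := gen _ y0.
rewrite Di Dj in nx ny *; rewrite -exprD; apply: (sq).
by rewrite oddD (contraR (sq i) nx) (contraR (sq j) ny).
Qed.

(** * Automorphisms acting on roots of unity and on quadratic irrationalities *)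

Section CyclotomicQuadratic.

Variables (p : nat) (M : splittingFieldType rat) (z : M).
Hypotheses (p_pr : prime p) (prim_z : p.-primitive_root z).

Local Notation G := 'Gal({:M} / 1).

Lemma gal_prim_root (s : gal_of {:M}) :
  exists2 k : 'F_p, k != 0 & s z = z ^+ k.
Proof.
have [|k Dk] := prim_rootFpP p_pr prim_z (x := s z).
  by rewrite -rmorphXn (prim_expr_order prim_z) rmorph1.
exists k => //; apply/eqP => k0; move: Dk; rewrite k0 expr0 => /eqP.
rewrite fmorph_eq1 -[z]expr1 -(prim_order_dvd prim_z) dvdn1 => /eqP p1.
by have := prime_gt1 p_pr; rewrite p1.
Qed.

(** [z ^+ k] is again a primitive root, hence a root of the irreducible ['Phi_p]. *)
Lemma exists_gal_prim_root (k : 'F_p) : k != 0 ->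
  exists2 s, s \in G & s z = z ^+ k.
Proof.
move=> k0; have p_gt0 := prime_gt0 p_pr.
apply: (gal_conj_root (irreducible_Cyclotomic p_gt0));
  apply: root_Cyclotomic_prime => //.
rewrite prim_root_exp_coprime // coprime_sym prime_coprime //.
by rewrite gtnNdvd ?ltn_Fp // lt0n.
Qed.

Lemma gal_adjoin_prim_root (s t : gal_of {:M}) x :
  x \in <<1; z>>%VS -> s z = t z -> s x = t x.
Proof.
by case/Fadjoin_polyP=> q /polyOver1P[r ->] -> stz; rewrite !gal_horner_rat stz.
Qed.

Lemma gal_quadratic (s : gal_of {:M}) (x : M) (r : rat) :
  x ^+ 2 = r%:A -> s x = x \/ s x = - x.
Proof.
move=> x2; have : (s x) ^+ 2 == x ^+ 2.
  by rewrite -rmorphXn x2 /= linearZ /= rmorph1.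
by rewrite eqf_sqr => /orP[]/eqP; [left|right].
Qed.

(* The unit group of [F_p] is cyclic, so [Q(z)] contains a single quadratic
   field: the one fixed by the automorphisms [z -> z ^ k] with [k] a square. *)
Lemma gal_quadratic_cyclotomic (s : gal_of {:M}) (x : M) (r : rat) (k : 'F_p) :
    x \in <<1; z>>%VS -> x ^+ 2 = r%:A -> (forall q : rat, x <> q%:A) ->
    s z = z ^+ k -> k != 0 ->
  (s x == x) = [exists u, k == u ^+ 2].
Proof.
move=> xz x2 xnQ Dk k0.
have sq_fix (t : gal_of {:M}) (l : 'F_p) : t z = z ^+ l -> l != 0 ->
    [exists u, l == u ^+ 2] -> t x = x.
  move=> Dl l0 /existsP[u /eqP lu].
  have u0 : u != 0 by apply: contraNneq l0 => u0; rewrite lu u0 expr0n.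
  have [v _ Dv] := exists_gal_prim_root u0.
  (* On [Q(z)], [t] is the square of the automorphism [v] sending [z] to [z ^+ u]; as [v x] is [x]
     or [- x], applying [v] twice fixes [x]. *)
  have -> : t x = (v * v)%g x.
    apply: gal_adjoin_prim_root => //.
    by rewrite galM ?memvf // Dl Dv rmorphXn /= Dv lu expr2 exprFpM.
  rewrite galM ?memvf //; have [vx|vx] := gal_quadratic v x2; first by rewrite !vx.
  by rewrite vx rmorphN /= vx opprK.
apply/eqP/idP => [sx|]; last exact: sq_fix.
(* If [s] fixed [x] with [k] a nonsquare, every [t] would fix [x]: for a nonsquare [l] the product
   [k * l] is a square, so [s * t] fixes [x], and hence so does [t]. Then [x] would be rational. *)
apply: contraT => nsq; have [q xq] : exists q : rat, x = q%:A; last by case: (xnQ q).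
apply: mem1_gal => t _; have [l l0 Dl] := gal_prim_root t.
have [sql|nsql] := boolP [exists u, l == u ^+ 2]; first exact: sq_fix sql.
have := @sq_fix (s * t)%g (k * l); rewrite !galM ?memvf // sx; apply.
- by rewrite Dk rmorphXn /= Dl exprFpM // exprAC.
- by rewrite mulf_neq0.
- exact: mul_nonsquare_finField.
Qed.

End CyclotomicQuadratic.

(** * Identifying a Galois group by comparing orders *)

Lemma gal_onto_by_dim (M : splittingFieldType rat) (E : {subfield M})
    (rT : finGroupType) (H : {group rT}) (f : gal_of {:M} -> rT) :
    {in 'Gal({:M} / 1) &, {morph f : s t / (s * t)%g}} ->
    (forall s, s \in 'Gal({:M} / 1) -> f s \in H) ->
    (forall s, s \in 'Gal({:M} / 1) -> f s = 1%g -> {in E, forall x, s x = x}) ->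
    (#|H| <= \dim E)%N ->
  (forall t, t \in H -> exists2 s, s \in 'Gal({:M} / 1) & f s = t) /\
  (E = fullv :> {vspace M} -> 'Gal({:M} / 1) \isog H).
Proof.
move=> fM fH fK leHE; pose fm := Morphism fM.
have sub : fm @* 'Gal({:M} / 1) \subset H.
  by apply/subsetP=> _ /morphimP[s _ Gs ->]; apply: fH.
have sK : 'ker fm \subset 'Gal({:M} / E).
  apply/subsetP=> s /morphpreP[Gs /set1P fs1].
  by rewrite gal_kHom ?subvf //; apply/kAHomP; apply: fK.
have cardG : #|'Gal({:M} / 1)| = (#|'Gal({:M} / E)| * \dim E)%N.
  rewrite -!galois_dim ?galois_rat // dimv1 divn1.
  exact: dim_sup_field (subvf E).
(* The kernel lies in ['Gal({:M} / E)], whose index is [\dim E], so the image has at least [\dim E]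
   elements; with [#|H| <= \dim E] it fills [H]. *)
have le_im : (\dim E <= #|fm @* 'Gal({:M} / 1)|)%N.
  rewrite card_morphim /= setIid.
  rewrite -(leq_pmul2l (cardG_gt0 ('ker fm))) Lagrange ?subsetIl //.
  by rewrite cardG leq_mul2r subset_leq_card ?orbT.
have imH : fm @* 'Gal({:M} / 1) = H.
  by apply/eqP; rewrite eqEcard sub (leq_trans leHE).
split=> [t|EM]; first by rewrite -imH => /morphimP[s _ Gs ->]; exists s.
rewrite -[X in _ \isog X]imH; apply: (sub_isog (f := fm)) => //.
apply: subset_trans sK _.
apply/subsetP=> s; rewrite gal_kHom ?subvf // => /kAHomP s1.
by apply/set1P/eqP/gal_eqP=> x _; rewrite gal_id s1 // EM memvf.
Qed.

Section RootPermutation.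

Variables (I : finType) (M : splittingFieldType rat) (T : I -> M).

(* The identity if [s] does not permute the values of [T]. *)
Definition gal_perm (s : gal_of {:M}) : {perm I} :=
  odflt 1%g [pick t : {perm I} | [forall j, T (t j) == s (T j)]].

Lemma gal_permE (s : gal_of {:M}) (t : {perm I}) :
  injective T -> (forall j, T (t j) = s (T j)) -> gal_perm s = t.
Proof.
move=> injT Tt; rewrite /gal_perm; case: pickP => /= [u /forallP Tu|/(_ t)].
  by apply/permP=> j; apply: injT; rewrite Tt; apply/eqP.
by case/forallP=> j; rewrite Tt.
Qed.

End RootPermutation.

Lemma ex_affine_perm p (k i : 'F_p) : k != 0 ->
  exists t : {perm 'F_p}, forall x, t x = k * x + i.
Proof.
move=> k0; have inj : injective (fun x => k * x + i).
  by move=> x y /addIr/(mulfI k0).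
by exists (perm inj) => x; rewrite permE.
Qed.

Lemma card_Aff p : prime p -> #|Aff p| = (p * p.-1)%N.
Proof. by move/Aff_sdprod=> [K [H [/sdprod_card<- [_ ->] [_ ->]]]]. Qed.

Lemma card_AffSq p : prime p -> odd p -> #|AffSq p| = (p * (p.-1 %/ 2))%N.
Proof. by move=> /AffSq_sdprod/[apply] -[K [H [/sdprod_card<- [_ ->] [_ ->]]]]. Qed.

(** * Dickson polynomials *)

Lemma dickson_horner (F : fieldExtType rat) (c : rat) (u v : F) k :
  u * v = c%:A -> (map_poly (in_alg F) (dickson c k)).[u + v] = u ^+ k + v ^+ k.
Proof.
(* The recurrence has two terms, so two consecutive indices are carried along. [D_2] is checked
   separately because it has its own clause in the definition. *)
move=> uv; suff: (map_poly (in_alg F) (dickson c k)).[u + v] = u ^+ k + v ^+ k /\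
    (map_poly (in_alg F) (dickson c k.+1)).[u + v] = u ^+ k.+1 + v ^+ k.+1 by case.
elim: k => [|[|k] [IH1 IH2]]; split=> //.
- by rewrite /= map_polyC hornerC /= scaler_nat !expr0.
- by rewrite /= map_polyX hornerX !expr1.
- rewrite /= rmorphB /= map_polyXn map_polyC !hornerE /= -scalerA -uv scaler_nat.
  by ring.
have -> : dickson c k.+3 = 'X * dickson c k.+2 - c%:P * dickson c k.+1 by [].
move: (dickson c k.+1) (dickson c k.+2) IH1 IH2 => D1 D2 IH1 IH2.
rewrite rmorphB !rmorphM /= map_polyX map_polyC hornerD hornerN !hornerM.
rewrite hornerX hornerC IH1 IH2 /= -uv !exprS.
by move: (u ^+ k) (v ^+ k) => x y; ring.
Qed.

Lemma dickson_monic_size (c : rat) k :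
  dickson c k.+1 \is monic /\ size (dickson c k.+1) = k.+2.
Proof.
suff: (dickson c k.+1 \is monic /\ size (dickson c k.+1) = k.+2) /\
   (dickson c k.+2 \is monic /\ size (dickson c k.+2) = k.+3) by case.
elim: k => [|k [IH1 IH2]]; split=> //.
- by rewrite monicX size_polyX.
- by rewrite -[dickson c 2]/('X^2 - (2%:R * c)%:P) monicXnsubC // size_XnsubC.
have -> : dickson c k.+3 = 'X * dickson c k.+2 - c%:P * dickson c k.+1 by [].
case: IH1 => m1 s1; case: IH2 => m2 s2.
have sX : size ('X * dickson c k.+2) = k.+4.
  by rewrite size_monicM ?monicX ?monic_neq0 // size_polyX s2.
have sc : (size (- (c%:P * dickson c k.+1)) < k.+4)%N.
  by rewrite size_polyN mul_polyC (leq_ltn_trans (size_scale_leq _ _)) // s1.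
rewrite size_polyDl sX //; split=> //.
by rewrite monicE lead_coefDl ?sX // -monicE monicMl ?monicX.
Qed.

(** * The roots of [h] and of [d_h], and how automorphisms move them *)

Section TrinomialRoots.

Variables (p : nat) (b c : rat).
Hypothesis p_pr : prime p.
Hypothesis irr_h : irreducible_poly (h_poly p b c).

Lemma h_poly_monic_size : h_poly p b c \is monic /\ size (h_poly p b c) = (2 * p).+1.
Proof.
have p_gt0 := prime_gt0 p_pr.
have lt2p : (size (b%:P * 'X^p + (c ^+ p)%:P)%R < (2 * p).+1)%N.
  rewrite ltnS (leq_trans (size_polyD _ _)) // geq_max.
  rewrite (leq_trans (size_polyC_leq1 _)) ?andbT; last by lia.
  by rewrite mul_polyC (leq_trans (size_scale_leq _ _)) // size_polyXn; lia.
rewrite /h_poly -addrA size_polyDl ?size_polyXn //; split=> //.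
by rewrite monicE lead_coefDl ?size_polyXn // lead_coefXn.
Qed.

Lemma h_poly_horner (F : fieldExtType rat) (x : F) :
  (map_poly (in_alg F) (h_poly p b c)).[x] =
    (x ^+ p) ^+ 2 + b%:A * x ^+ p + (c%:A) ^+ p.
Proof.
rewrite /h_poly !rmorphD rmorphM /= !map_polyXn !map_polyC !hornerE /=.
by rewrite -exprM mulnC exprZn expr1n.
Qed.

(** Otherwise [X] would be a proper factor of [h]. *)
Lemma h_poly_const_neq0 : c != 0.
Proof.
apply/eqP=> c0; have [_ sz_h] := h_poly_monic_size; have p_gt1 := prime_gt1 p_pr.
have p0 : (p == 0%N) = false by lia.
have dvdXh : 'X %| h_poly p b c.
  rewrite -['X]subr0 -polyC0 dvdp_XsubCl rootE /h_poly c0 !hornerE !expr0n.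
  by rewrite muln_eq0 p0 mulr0 !addr0.
have := irr_h.2 _ _ dvdXh; rewrite size_polyX => /(_ isT)/eqp_size.
by rewrite size_polyX sz_h; lia.
Qed.

Variables (M : splittingFieldType rat) (a z : M).
Hypothesis ha0 : root (map_poly (in_alg M) (h_poly p b c)) a.

(** The [p]-th powers of [a] and [a'] are the two roots of [y^2 + b y + c^p]. *)
Definition conj_root := c%:A / a.
Local Notation a' := conj_root.
Definition sqrt_disc := a ^+ p - a' ^+ p.
Local Notation delta := sqrt_disc.
Definition dickson_root (j : 'F_p) := z ^+ j * a + z ^+ (- j)%R * a'.
Local Notation T := dickson_root.

Lemma dim_adjoin_root : \dim <<1; a>> = (2 * p)%N.
Proof.
have [mon_h sz_h] := h_poly_monic_size.
by rewrite (dim_adjoin_irreducible irr_h mon_h ha0) sz_h.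
Qed.

Lemma root_neq0 : a != 0.
Proof.
have := h_poly_const_neq0; apply: contraNneq => a0; move: ha0; rewrite a0.
rewrite rootE h_poly_horner !expr0n gtn_eqF ?prime_gt0 // !expr0n mulr0 !add0r.
by rewrite expf_eq0 prime_gt0 //= -in_algE fmorph_eq0.
Qed.

Lemma mul_conj_root : a * a' = c%:A.
Proof. by rewrite /conj_root mulrC divfK // root_neq0. Qed.

Lemma conj_root_neq0 : a' != 0.
Proof.
by rewrite mulf_neq0 ?invr_eq0 ?root_neq0 // -in_algE fmorph_eq0 h_poly_const_neq0.
Qed.

Lemma add_conj_rootX : a ^+ p + a' ^+ p = - b%:A.
Proof.
have a0 : a ^+ p != 0 by rewrite expf_neq0 ?root_neq0.
apply: (mulfI a0); move: ha0; rewrite rootE h_poly_horner -mul_conj_root.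
rewrite (exprMn p a a') => /eqP E; apply/eqP; rewrite -subr_eq0 -E; apply/eqP; ring.
Qed.

Lemma sqrt_discK : delta ^+ 2 = (b ^+ 2 - 4%:R * c ^+ p)%:A.
Proof.
have algX (x : rat) n : (x ^+ n)%:A = x%:A ^+ n :> M by rewrite exprZn expr1n.
rewrite scalerBl -(scalerA 4%:R) scaler_nat !algX.
rewrite -mul_conj_root (exprMn p a a') -[b%:A]opprK -add_conj_rootX /sqrt_disc.
by ring.
Qed.

(** A rational [delta] would make [a^p = (delta - b) / 2] rational, so that [a] would have degree at
    most [p] instead of [2 p]. *)
Lemma sqrt_disc_irrational (q : rat) : delta <> q%:A.
Proof.
move=> Dq; have ap : a ^+ p = ((q - b) / 2%:R)%:A.
  have two0 : (2%:R : M) != 0 by rewrite -(rmorph_nat (in_alg M)) fmorph_eq0.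
  apply: (mulfI two0); rewrite -in_algE rmorphM fmorphV rmorph_nat rmorphB /=.
  rewrite -Dq -add_conj_rootX /sqrt_disc.
  by field.
have := @minPoly_dvdp _ _ 1%AS a (map_poly (in_alg M) ('X^p - ((q - b) / 2%:R)%:P)).
rewrite rmorphB /= map_polyXn map_polyC /= => dvd.
have /dvdp_leq : minPoly 1 a %| 'X^p - (((q - b) / 2%:R)%:A)%:P.
  apply: dvd; last by rewrite rootE !hornerE ap subrr.
  by rewrite rpredB ?rpredX ?polyOverX // polyOverC rpredZ ?mem1v.
rewrite -size_poly_eq0 size_XnsubC ?prime_gt0 // size_minPoly => /(_ isT).
have := dim_adjoin_root; rewrite adjoin_degreeE dimv1 divn1 => ->.
by have := prime_gt0 p_pr; lia.
Qed.

Lemma sqrt_disc_neq0 : delta != 0.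
Proof. by apply/eqP=> d0; apply: (@sqrt_disc_irrational 0); rewrite scale0r. Qed.

Lemma trinomial_rootX (x : M) :
    root (map_poly (in_alg M) (h_poly p b c)) x ->
  x ^+ p = a ^+ p \/ x ^+ p = a' ^+ p.
Proof.
rewrite rootE h_poly_horner => hx.
have : (x ^+ p - a ^+ p) * (x ^+ p - a' ^+ p) == 0.
  rewrite -(eqP hx) -mul_conj_root (exprMn p a a') -[b%:A]opprK -add_conj_rootX.
  by apply/eqP; ring.
by rewrite mulf_eq0 !subr_eq0 => /orP[]/eqP; [left|right].
Qed.

Hypothesis prim_z : p.-primitive_root z.

Lemma trinomial_roots (x : M) :
    root (map_poly (in_alg M) (h_poly p b c)) x ->
  exists i : 'F_p, x = z ^+ i * a \/ x = z ^+ i * a'.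
Proof.
move/trinomial_rootX=> [] xp.
  have [|i Di] := prim_rootFpP p_pr prim_z (x := x / a).
    by rewrite exprMn exprVn xp divff ?expf_neq0 ?root_neq0.
  by exists i; left; rewrite -Di divfK ?root_neq0.
have [|i Di] := prim_rootFpP p_pr prim_z (x := x / a').
  by rewrite exprMn exprVn xp divff ?expf_neq0 ?conj_root_neq0.
by exists i; right; rewrite -Di divfK ?conj_root_neq0.
Qed.

Lemma exprFp_orderp (i : 'F_p) : (z ^+ i) ^+ p = 1.
Proof. by rewrite exprAC (prim_expr_order prim_z) expr1n. Qed.

Lemma exprFp_neq0 (i : 'F_p) : z ^+ i != 0.
Proof. by rewrite expf_neq0 // (prim_root_eq0 prim_z) -lt0n prime_gt0. Qed.

(** [T i - T j] factors as [(z^i - z^j) (a - a' / (z^i z^j))]. If the second factor vanished, taking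
    [p]-th powers would give [delta = 0]. *)
Lemma dickson_root_inj : injective T.
Proof.
move=> i j; rewrite /dickson_root => /eqP; rewrite -subr_eq0 !exprFpN // => E.
have [zi zj] := (exprFp_neq0 i, exprFp_neq0 j).
have : (z ^+ i - z ^+ j) * (a - a' / (z ^+ i * z ^+ j)) == 0.
  by rewrite -(eqP E); apply/eqP; field; rewrite zi zj.
rewrite mulf_eq0 !subr_eq0 => /orP[/eqP/(exprFp_inj p_pr prim_z) //|/eqP aE].
have := sqrt_disc_neq0; rewrite /sqrt_disc {1}aE (expr_div_n a').
by rewrite (exprMn p (z ^+ i)) !exprFp_orderp mul1r divr1 subrr eqxx.
Qed.

(** [T j] is a sum [u + v] with [u v = c], so [D_p] takes there the value
    [u^p + v^p = a^p + a'^p = - b]. *)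
Lemma root_dickson_root j : root (map_poly (in_alg M) (d_poly p b c)) (T j).
Proof.
rewrite rootE /d_poly rmorphD /= map_polyC hornerD hornerC /dickson_root.
rewrite dickson_horner; last first.
  by rewrite exprFpN // mulrACA mul_conj_root divff ?exprFp_neq0 // mul1r.
by rewrite !(exprMn p (z ^+ _)) !exprFp_orderp !mul1r add_conj_rootX addNr.
Qed.

Lemma d_poly_monic_size : d_poly p b c \is monic /\ size (d_poly p b c) = p.+1.
Proof.
have := dickson_monic_size c p.-1; rewrite prednK ?prime_gt0 // => -[mon_d sz_d].
have lt_b : (size b%:P < size (dickson c p))%N.
  by rewrite sz_d (leq_ltn_trans (size_polyC_leq1 _)) // ltnS prime_gt0.
by rewrite /d_poly size_polyDl // sz_d monicE lead_coefDl // -monicE.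
Qed.

Lemma d_poly_factor :
  map_poly (in_alg M) (d_poly p b c) = \prod_(j : 'F_p) ('X - (T j)%:P).
Proof.
have [mon_d sz_d] := d_poly_monic_size.
rewrite [LHS](@all_roots_prod_XsubC _ _ (map T (enum 'F_p))).
- by rewrite lead_coef_map (monicP mon_d) rmorph1 scale1r big_map big_enum.
- by rewrite size_map_poly sz_d size_map -cardE card_Fp.
- by apply/allP=> _ /mapP[j _ ->]; apply: root_dickson_root.
- by rewrite uniq_rootsE (map_inj_uniq dickson_root_inj) enum_uniq.
Qed.

Lemma gal_trinomial (s : gal_of {:M}) :
  exists (e : bool) (k i : 'F_p) (t : {perm 'F_p}),
   [/\ k != 0, s z = z ^+ k, s a = z ^+ i * (if e then a' else a),
       s delta = (-1) ^+ e * delta &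
      (forall x, t x = (-1) ^+ e * (k * x + i)) /\ forall j, T (t j) = s (T j)].
Proof.
have [k k0 Dk] := gal_prim_root p_pr prim_z s.
have sT j : s (T j) = (s z) ^+ j * s a + (s z) ^+ (- j)%R * s a'.
  by rewrite /dickson_root rmorphD (rmorphM _ _ a) (rmorphM _ _ a') !rmorphXn.
have [i [sa|sa]] := trinomial_roots (gal_root_rat s ha0).
  have sa' : s a' = z ^+ (- i)%R * a'.
    rewrite exprFpN // /conj_root fmorph_div /= sa linearZ /= rmorph1 invfM.
    by rewrite mulrCA.
  have [t Dt] := ex_affine_perm i k0.
  exists false, k, i, t; split=> //.
    rewrite expr0 mul1r /sqrt_disc rmorphB !rmorphXn /= sa sa'.
    rewrite !(exprMn p (z ^+ _)) !exprFp_orderp.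
    by rewrite !mul1r.
  split=> [x|j]; first by rewrite expr0 mul1r.
  rewrite sT Dt Dk sa sa' -!exprFpM // mulrN /dickson_root opprD !exprFpD //.
  by rewrite -!mulrA.
have sa' : s a' = z ^+ (- i)%R * a.
  rewrite exprFpN // /conj_root fmorph_div /= sa linearZ /= rmorph1 -mul_conj_root.
  by field; rewrite exprFp_neq0 conj_root_neq0.
have Nk0 : - k != 0 by rewrite oppr_eq0.
(* Exchanging [a] and [a'] negates the index of [T], so the permutation is [x -> - (k x + i)]. *)
have [t Dt] := ex_affine_perm (- i) Nk0.
exists true, k, i, t; split=> //.
  rewrite expr1 mulN1r /sqrt_disc rmorphB !rmorphXn /= sa sa'.
  rewrite !(exprMn p (z ^+ _)) !exprFp_orderp.
  by rewrite !mul1r opprB.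
split=> [x|j]; first by rewrite expr1 mulN1r opprD -mulNr.
rewrite sT Dt Dk sa sa' -!exprFpM // mulrN /dickson_root mulNr -opprD opprK.
by rewrite opprD !exprFpD // -!mulrA addrC.
Qed.

End TrinomialRoots.

(** * Squares in Q and in ['F_p], and the quadratic subfield of [Q(z)] *)

Lemma sign_prime_not_square p e (q : rat) :
  prime p -> (-1) ^+ e * p%:R <> q ^+ 2.
Proof.
move=> p_pr Dq; have p_gt0 := prime_gt0 p_pr.
have num0 : numq q != 0.
  rewrite numq_eq0; apply/eqP=> q0; have /eqP := Dq.
  by rewrite q0 expr0n mulf_eq0 signr_eq0 pnatr_eq0 gtn_eqF.
have : numq q ^+ 2 = (-1) ^+ e * p%:R * denq q ^+ 2.
  apply: (@intr_inj rat); rewrite rmorphXn /= numqE exprMn -Dq.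
  by rewrite 2!rmorphM /= rmorph_sign rmorph_nat rmorphXn.
move/(congr1 absz); rewrite !abszM !abszX abszN1 exp1n mul1n natz absz_nat.
(* The [p]-adic valuation is even on the left and odd on the right. *)
move/(congr1 (logn p)); rewrite !lognM ?muln_gt0 ?absz_gt0 ?denq_neq0 ?num0 //.
by rewrite (logn_prime p p_pr) eqxx; lia.
Qed.

(** The group of nonzero squares has even order [(p - 1) / 2], so by Cauchy it contains an element
    of order 2, which can only be [-1]. *)
Lemma Fp_N1_square p : prime p -> p = 1 %[mod 4] -> [exists u : 'F_p, -1 == u ^+ 2].
Proof.
move=> p_pr p1; have p_odd : odd p by lia.
have : (2 %| #|(sq_morphism p @* setT)%g|)%N.
  by rewrite card_sq_unit_Fp //; have := prime_gt1 p_pr; lia.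
case/(Cauchy (isT : prime 2)) => x /morphimP[u _ _ Dx] ox.
have x2 : (FinRing.uval x) ^+ 2 == 1.
  by rewrite -FinRing.val_unitX -ox expg_order.
have x1 : FinRing.uval x != 1.
  apply/eqP=> x1; have E : x = 1%g by apply: val_inj.
  by rewrite E order1 in ox.
apply/existsP; exists (FinRing.uval u); rewrite -FinRing.val_unitX.
by move: x2; rewrite sqrf_eq1 (negPf x1) /= Dx eq_sym.
Qed.

(** With [p = 4 m + 3] and [u^2 = -1], Fermat gives [u = u^p = (u^2)^(2 m) u^3 = - u], which is
    impossible for odd [p]. *)
Lemma Fp_N1_nonsquare p :
  prime p -> p = 3 %[mod 4] -> ~~ [exists u : 'F_p, -1 == u ^+ 2].
Proof.
move=> p_pr p3; apply/existsP=> -[u /eqP u2].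
have u0 : u != 0.
  by apply/eqP=> u0; have /eqP := u2; rewrite u0 expr0n oppr_eq0 oner_eq0.
have Dp : p = (2 * (2 * (p %/ 4)) + 3)%N by lia.
have := expf_card u; rewrite card_Fp // [X in u ^+ X]Dp exprD exprM -u2 exprM.
rewrite sqrrN !expr1n mul1r exprS -u2 mulrN1 => /eqP.
rewrite eq_sym -subr_eq0 opprK -mulr2n -mulr_natl mulf_eq0 (negPf u0) orbF.
rewrite -(dvdn_pcharf (pchar_Fp p_pr)) => /dvdn_leq/=; have := prime_gt1 p_pr; lia.
Qed.

Section CyclotomicSqrt.

Variables (p : nat) (M : splittingFieldType rat) (z : M).
Hypotheses (p_pr : prime p) (p_odd : odd p) (prim_z : p.-primitive_root z).

Lemma cyclotomic_sqrt_prime :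
  exists2 x : M, x \in <<1; z>>%VS & x ^+ 2 = ((-1) ^+ p./2 * p%:R)%:A.
Proof.
have Dp : p = p./2.*2.+1 by lia.
have := prim_z; rewrite [X in X.-primitive_root _]Dp => /sqrt_prime_prim_root.
rewrite -Dp => Dx; eexists; last first.
  by rewrite -[RHS](in_algE M) rmorphM rmorph_nat rmorph_sign; apply: Dx.
apply: rpred_prod => i _; rewrite rpredB ?rpredV ?rpredX //; exact: memv_adjoin.
Qed.

(* Two quadratic irrationalities of [Q(z)] have a rational product. *)
Lemma mem_cyclotomic_quadratic (x : M) (r : rat) :
    x ^+ 2 = r%:A -> (forall q : rat, x <> q%:A) ->
  x \in <<1; z>>%VS <-> in_rat_sq_class ((-1) ^+ p./2 * p%:R) r.
Proof.
move=> x2 xnQ; have [y yz y2] := cyclotomic_sqrt_prime.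
have ynQ q : y <> q%:A.
  move=> Dy; apply: (@sign_prime_not_square p p./2 q p_pr).
  apply: (fmorph_inj (in_alg M)); rewrite /= -y2 Dy.
  by rewrite exprZn expr1n.
split=> [xz|[q Dr]].
  (* Each automorphism fixes both [x] and [y] or negates both, according to the quadratic character
     of the same [k]. *)
  have [q Dq] : exists q : rat, x * y = q%:A.
    apply: mem1_gal => s Gs; have [k k0 Dk] := gal_prim_root p_pr prim_z s.
    rewrite rmorphM /=.
    have Ex := gal_quadratic_cyclotomic p_pr prim_z xz x2 xnQ Dk k0.
    have := gal_quadratic_cyclotomic p_pr prim_z yz y2 ynQ Dk k0; rewrite -Ex.
    have [->|sx] := gal_quadratic s x2; first by rewrite eqxx => /eqP->.
    have [->|sy] := gal_quadratic s y2; last by rewrite sx sy mulrNN.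
    by rewrite eqxx sx => /esym/eqP->.
  set ps := (-1) ^+ p./2 * p%:R in y2 *.
  have ps0 : ps != 0 by rewrite mulf_neq0 ?signr_eq0 // pnatr_eq0 -lt0n prime_gt0.
  (* Squaring [x * y = q] gives [r * ps = q ^+ 2], that is [r = ps * (q / ps) ^+ 2]. *)
  exists (q / ps); apply: (mulIf ps0).
  have -> : r * ps = q ^+ 2; last by field.
  apply: (fmorph_inj (in_alg M)); rewrite rmorphM rmorphXn /= -x2 -y2 -Dq.
  by rewrite exprMn.
have : x ^+ 2 == (q%:A * y) ^+ 2.
  by rewrite x2 Dr exprMn y2 exprZn expr1n -!in_algE -rmorphM mulrC.
have qyz : q%:A * y \in <<1; z>>%VS by rewrite mulr_algl rpredZ.
by rewrite eqf_sqr => /orP[]/eqP->; rewrite ?rpredN.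
Qed.

End CyclotomicSqrt.

Lemma gal_fix_adjoin2 (M : splittingFieldType rat) (s : gal_of {:M}) (x y : M) :
  s x = x -> s y = y -> {in <<<<1; x>>; y>>%AS, forall w, s w = w}.
Proof.
move=> sx sy; pose K := fixedField [set s].
have inK u : s u = u -> u \in K.
  by move=> su; apply/fixedFieldP; rewrite ?memvf // => t /set1P->.
have subK : (<<<<1; x>>; y>>%AS <= K)%VS.
  by apply/FadjoinP; rewrite inK //; split=> //; apply/FadjoinP; rewrite inK // sub1v.
by move=> w /(subvP subK)/mem_fixedFieldP[_]; apply; apply: set11.
Qed.

(** No isomorphism with the Galois group of [M] is asserted, because [M] may be larger than the
    field generated by the values of [T]. *)
Definition galois_acts_as (I : finType) (M : splittingFieldType rat) (T : I -> M)
    (H : {set {perm I}}) :=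
  (forall s, s \in 'Gal({:M} / 1) ->
     exists2 t, t \in H & forall j, T (t j) = s (T j)) /\
  (forall t, t \in H ->
     exists2 s, s \in 'Gal({:M} / 1) & forall j, T (t j) = s (T j)).

(** * The Galois action on [Q(z, a)] *)

Section TrinomialGalois.

Variables (p : nat) (b c : rat).
Hypotheses (p_pr : prime p) (p_odd : odd p).
Hypothesis irr_h : irreducible_poly (h_poly p b c).
Variables (M : splittingFieldType rat) (a z : M).
Hypothesis ha0 : root (map_poly (in_alg M) (h_poly p b c)) a.
Hypothesis prim_z : p.-primitive_root z.

Local Notation G := 'Gal({:M} / 1).
Local Notation delta := (sqrt_disc p c a).
Local Notation T := (@dickson_root p c M a z).
Local Notation E := <<<<1; z>>; a>>%AS.

Let injT : injective T := dickson_root_inj p_pr irr_h ha0 prim_z.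
Let gal_shape := gal_trinomial p_pr irr_h ha0 prim_z.

Lemma gal_permM (s t : gal_of {:M}) :
  gal_perm T (s * t)%g = (gal_perm T s * gal_perm T t)%g.
Proof.
have [_ [_ [_ [u [_ _ _ _ [_ Tu]]]]]] := gal_shape s.
have [_ [_ [_ [v [_ _ _ _ [_ Tv]]]]]] := gal_shape t.
rewrite (gal_permE injT Tu) (gal_permE injT Tv); apply: gal_permE => // j.
by rewrite permM Tv Tu galM ?memvf.
Qed.

Lemma gal_sign (s : gal_of {:M}) (e : bool) :
  s delta = (-1) ^+ e * delta -> (s delta != delta) = e.
Proof.
move->; case: e; last by rewrite expr0 mul1r eqxx.
rewrite expr1 mulN1r eq_sym -subr_eq0 opprK -mulr2n -mulr_natl mulf_neq0 //.
  by rewrite -(rmorph_nat (in_alg M)) fmorph_eq0.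
exact: (sqrt_disc_neq0 p_pr irr_h ha0).
Qed.

Definition gal_perm_sign (s : gal_of {:M}) : {perm 'F_p} * 'Z_2 :=
  (gal_perm T s, (s delta != delta)%:R).

Lemma gal_perm_signM : {morph gal_perm_sign : s t / (s * t)%g}.
Proof.
move=> s t; rewrite /gal_perm_sign gal_permM; congr pair.
have [e [_ [_ [_ [_ _ _ se _]]]]] := gal_shape s.
have [f [_ [_ [_ [_ _ _ tf _]]]]] := gal_shape t.
have st : (s * t)%g delta = (-1) ^+ (e (+) f) * delta.
  by rewrite galM ?memvf // se rmorphM rmorph_sign /= tf mulrA signr_addb.
rewrite (gal_sign se) (gal_sign tf) (gal_sign st).
by case: e {se st}; case: f {tf}; apply: val_inj.
Qed.

Lemma gal_affine_id (s : gal_of {:M}) (k i : 'F_p) (t : {perm 'F_p}) :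
    s z = z ^+ k -> s a = z ^+ i * a -> (forall x, t x = k * x + i) -> t = 1%g ->
  {in E, forall x, s x = x}.
Proof.
move=> sz sa Dt t1.
have i0 : i = 0 by have := Dt 0; rewrite t1 perm1 mulr0 add0r.
have k1 : k = 1 by have := Dt 1; rewrite t1 perm1 mulr1 i0 addr0.
apply: gal_fix_adjoin2; last by rewrite sa i0 expr0 mul1r.
by rewrite sz k1 -[1]/(1%:R) exprFp_nat.
Qed.

(** Fixing [delta] forces [e = 0]; a trivial map [x -> k x + i] then has [k = 1] and [i = 0], so [z]
    and [a] are fixed. *)
Lemma gal_perm_sign_ker (s : gal_of {:M}) :
  gal_perm_sign s = 1%g -> {in E, forall x, s x = x}.
Proof.
have [e [k [i [t [k0 sz sa sd [Dt Tt]]]]]] := gal_shape s.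
rewrite /gal_perm_sign (gal_permE injT Tt) (gal_sign sd) => -[t1].
case: e sa Dt {sd} => //= sa Dt _; apply: gal_affine_id sz sa _ t1 => x.
by rewrite Dt expr0 mul1r.
Qed.

Lemma prim_root_mem_split : z \in E.
Proof. by rewrite subvP_adjoin // memv_adjoin. Qed.

Lemma root_mem_split : a \in E.
Proof. exact: memv_adjoin. Qed.

Lemma conj_root_mem_split : conj_root c a \in E.
Proof. by rewrite rpredM ?rpredV ?root_mem_split // rpredZ ?mem1v. Qed.

(** The degrees [p - 1] of [Q(z)] and [2 p] of [Q(a)] both divide, and [p] is prime to [p - 1]. *)
Lemma dim_split_dvd : (p * p.-1 %| \dim E)%N.
Proof.
have p2 := prime_gt1 p_pr.
rewrite Gauss_dvd; last by rewrite prime_coprime // gtnNdvd //; lia.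
rewrite -(dim_adjoin_prim_root p_pr prim_z) [X in _ && X]field_dimS ?subv_adjoin //.
rewrite andbT.
rewrite (@dvdn_trans (2 * p)) ?dvdn_mull // -(dim_adjoin_root p_pr irr_h ha0).
by rewrite field_dimS //; apply/FadjoinP; rewrite sub1v root_mem_split.
Qed.

Lemma dim_split_dvd2 : delta \notin <<1; z>>%VS -> (p * (2 * p.-1) %| \dim E)%N.
Proof.
move=> dnz; have p2 := prime_gt1 p_pr.
rewrite Gauss_dvd; last first.
  rewrite coprimeMr coprime_sym prime_coprime // dvdn2 negbK p_odd /=.
  by rewrite prime_coprime // gtnNdvd //; lia.
rewrite (dvdn_trans _ dim_split_dvd) ?dvdn_mulr //=.
have : (\dim <<<<1; z>>; delta>>%AS %| \dim E)%N.
  rewrite field_dimS //; apply/FadjoinP; rewrite subv_adjoin; split=> //.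
  by rewrite rpredB ?rpredX ?root_mem_split ?conj_root_mem_split.
rewrite dim_Fadjoin (dim_adjoin_prim_root p_pr prim_z).
(* [delta] has a rational square and lies outside [Q(z)], so it contributes a factor 2 on top of
   [p - 1]. *)
suff -> : adjoin_degree <<1; z>> delta = 2 by [].
apply/eqP; rewrite eqn_leq; apply/andP; split; last first.
  by rewrite ltn_neqAle eq_sym adjoin_deg_eq1 dnz.
have /dvdp_leq : minPoly <<1; z>> delta %| 'X^2 - (delta ^+ 2)%:P.
  apply: minPoly_dvdp; last by rewrite rootE !hornerE subrr.
  rewrite rpredB ?rpredX ?polyOverX // polyOverC (sqrt_discK p_pr irr_h ha0).
  by rewrite rpredZ ?mem1v.
by rewrite -size_poly_eq0 size_XnsubC // size_minPoly => /(_ isT).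
Qed.

Lemma gal_perm_Aff (s : gal_of {:M}) : gal_perm T s \in Aff p.
Proof.
have [e [k [i [t [k0 _ _ _ [Dt Tt]]]]]] := gal_shape s.
rewrite (gal_permE injT Tt); apply/AffP; exists ((-1) ^+ e * k), ((-1) ^+ e * i).
by split=> [|x]; rewrite ?mulf_neq0 ?signr_eq0 // Dt mulrDr mulrA.
Qed.

Lemma gal_sign_square (s : gal_of {:M}) (e : bool) (k : 'F_p) :
    delta \in <<1; z>>%VS -> s z = z ^+ k -> k != 0 ->
  s delta = (-1) ^+ e * delta -> [exists u, k == u ^+ 2] = ~~ e.
Proof.
move=> dz sz k0 sd; have dQ := sqrt_disc_irrational p_pr irr_h ha0.
rewrite -(gal_quadratic_cyclotomic p_pr prim_z dz (sqrt_discK p_pr irr_h ha0) dQ sz k0).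
by rewrite -(gal_sign sd) negbK.
Qed.

(** The slope is [(-1)^e k]. For [e = 0], [k] is a square; for [e = 1], both [k] and [-1] are
    nonsquares and their product is a square. *)
Lemma gal_perm_AffSq (s : gal_of {:M}) :
  delta \in <<1; z>>%VS -> p = 3 %[mod 4] -> gal_perm T s \in AffSq p.
Proof.
move=> dz p3; have [e [k [i [t [k0 sz _ sd [Dt Tt]]]]]] := gal_shape s.
have sqk := gal_sign_square dz sz k0 sd.
rewrite (gal_permE injT Tt) inE; apply/existsP; exists ((-1) ^+ e * k).
apply/existsP; exists ((-1) ^+ e * i); rewrite mulf_neq0 ?signr_eq0 //=.
apply/andP; split; last by apply/forallP=> x; rewrite Dt mulrDr mulrA.
case: e sqk {sd Dt} => /= sqk; last by rewrite expr0 mul1r sqk.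
by rewrite expr1 mul_nonsquare_finField ?sqk // Fp_N1_nonsquare.
Qed.

Let gal_permP (s : gal_of {:M}) j : T (gal_perm T s j) = s (T j).
Proof.
by have [_ [_ [_ [t [_ _ _ _ [_ Tt]]]]]] := gal_shape s; rewrite (gal_permE injT Tt).
Qed.

Lemma gal_generic : delta \notin <<1; z>>%VS ->
  galois_acts_as T (Aff p) /\
  (E = fullv :> {vspace M} -> G \isog setX_group (Aff_group p) [set: 'Z_2]%G).
Proof.
move=> dnz; have [] := @gal_onto_by_dim M E _
    (setX_group (Aff_group p) [set: 'Z_2]%G) gal_perm_sign.
- by move=> s t _ _; apply: gal_perm_signM.
- by move=> s _; rewrite inE gal_perm_Aff inE.
- by move=> s _; apply: gal_perm_sign_ker.
- rewrite cardsX cardsT card_ord card_Aff // -mulnA (mulnC p.-1).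
  by rewrite dvdn_leq ?adim_gt0 ?dim_split_dvd2.
move=> onto isoG; split=> //; split=> [s _|t Ht].
  by exists (gal_perm T s); [apply: gal_perm_Aff | apply: gal_permP].
(* The sign is a free choice; [0] selects an automorphism fixing [delta]. *)
have [|s Gs [Ds _]] := onto (t, 0); first by rewrite inE /= Ht inE.
by exists s => // j; rewrite -Ds gal_permP.
Qed.

(** The permutation alone is faithful on [E]: a trivial one with [e = 1] would have [k = -1], which
    is a square here, whereas [e = 1] makes [k] a nonsquare. *)
Lemma gal_1mod4 : delta \in <<1; z>>%VS -> p = 1 %[mod 4] ->
  galois_acts_as T (Aff p) /\
  (E = fullv :> {vspace M} -> G \isog Aff_group p).
Proof.
move=> dz p1; have [] := @gal_onto_by_dim M E _ (Aff_group p) (gal_perm T).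
- by move=> s t _ _; apply: gal_permM.
- by move=> s _; apply: gal_perm_Aff.
- move=> s _; have [e [k [i [t [k0 sz sa sd [Dt Tt]]]]]] := gal_shape s.
  rewrite (gal_permE injT Tt) => t1; have := gal_sign_square dz sz k0 sd.
  case: e sa Dt {sd} => /= sa Dt sqk; last first.
    by apply: gal_affine_id sz sa _ t1 => x; rewrite Dt expr0 mul1r.
  have i0 : i = 0.
    have := Dt 0; rewrite t1 perm1 mulr0 add0r expr1 mulN1r => /esym/eqP.
    by rewrite oppr_eq0 => /eqP.
  have kN1 : k = -1.
    have := Dt 1; rewrite t1 perm1 mulr1 i0 addr0 expr1 mulN1r => ->.
    by rewrite opprK.
  by rewrite kN1 Fp_N1_square in sqk.
- by rewrite card_Aff // dvdn_leq ?adim_gt0 ?dim_split_dvd.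
move=> onto isoG; split=> //; split=> [s _|t Ht].
  by exists (gal_perm T s); [apply: gal_perm_Aff | apply: gal_permP].
by have [s Gs Ds] := onto t Ht; exists s => // j; rewrite -Ds gal_permP.
Qed.

(** The sign has to be recorded: the pair [(1, 1)] is attained, by an automorphism inverting [z] and
    exchanging [a] and [a']. The target has order [p (p - 1)], which divides [\dim E]. *)
Lemma gal_3mod4 : delta \in <<1; z>>%VS -> p = 3 %[mod 4] ->
  galois_acts_as T (AffSq p) /\
  (E = fullv :> {vspace M} -> G \isog setX_group (AffSq_group p) [set: 'Z_2]%G).
Proof.
move=> dz p3; have [] := @gal_onto_by_dim M E _
    (setX_group (AffSq_group p) [set: 'Z_2]%G) gal_perm_sign.
- by move=> s t _ _; apply: gal_perm_signM.
- by move=> s _; rewrite inE gal_perm_AffSq // inE.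
- by move=> s _; apply: gal_perm_sign_ker.
- rewrite cardsX cardsT card_ord card_AffSq // -mulnA divnK; last by lia.
  by rewrite dvdn_leq ?adim_gt0 ?dim_split_dvd.
move=> onto isoG; split=> //; split=> [s _|t Ht].
  by exists (gal_perm T s); [apply: gal_perm_AffSq | apply: gal_permP].
have [|s Gs [Ds _]] := onto (t, 0); first by rewrite inE /= Ht inE.
by exists s => // j; rewrite -Ds gal_permP.
Qed.

(** As [h] is irreducible, some automorphism sends [a] to [z ^+ j * a], hence [a'] to
    [z ^- j * a']. *)
Lemma dickson_root_conj j : exists2 s, s \in G & s (T 0) = T j.
Proof.
have hj : root (map_poly (in_alg M) (h_poly p b c)) (z ^+ j * a).
  rewrite rootE h_poly_horner exprMn (exprFp_orderp prim_z) mul1r.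
  by rewrite -h_poly_horner -rootE.
have [s Gs sa] := gal_conj_root irr_h ha0 hj; exists s => //.
rewrite /dickson_root oppr0 !expr0 !mul1r rmorphD /= sa exprFpN //.
by congr (_ + _); rewrite /conj_root fmorph_div /= sa linearZ /= rmorph1 invfM mulrCA.
Qed.

(** A nonconstant factor vanishes at some [T i], hence by transitivity at all [p] of the distinct
    [T j], so it has full degree. *)
Lemma irreducible_d_poly : irreducible_poly (d_poly p b c).
Proof.
have [mon_d sz_d] := d_poly_monic_size b c p_pr.
split=> [|q sq qd]; first by rewrite sz_d ltnS prime_gt0.
have q0 : q != 0 by apply: dvdpN0 qd _; apply: monic_neq0.
have [i qi] : exists i, root (map_poly (in_alg M) q) (T i).
  have := qd; rewrite -(dvdp_map (in_alg M)) /= (d_poly_factor p_pr irr_h ha0 prim_z).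
  case/dvdp_prod_XsubC=> m Dq; move/eqp_size: (Dq); rewrite size_map_poly.
  rewrite size_prod_XsubC; case Dm: (mask m _) => [|i r] sz_q.
    by rewrite sz_q in sq.
  by exists i; rewrite (eqp_root Dq) Dm big_cons rootM root_XsubC eqxx.
have qT j : root (map_poly (in_alg M) q) (T j).
  have [s _ <-] := dickson_root_conj j; have [t _ Dt] := dickson_root_conj i.
  apply: gal_root_rat; have := gal_root_rat (t^-1)%g qi.
  by rewrite -Dt -galM ?memvf // mulgV gal_id.
rewrite -dvdp_size_eqp // eqn_leq dvdp_leq ?monic_neq0 // sz_d.
have := @max_poly_roots _ (map_poly (in_alg M) q) (map T (enum 'F_p)).
rewrite size_map_poly size_map -cardE card_Fp // map_poly_eq0 q0.
rewrite (map_inj_uniq injT) enum_uniq; apply=> //.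
by apply/allP=> _ /mapP[j _ ->].
Qed.

End TrinomialGalois.

(** * Roots of unity and generators in splitting fields of the trinomial *)

Lemma splitting_root (M : splittingFieldType rat) (f q : {poly rat}) :
    splittingFieldFor 1 (map_poly (in_alg M) f) {:M} -> q %| f ->
    (1 < size q)%N ->
  exists x, root (map_poly (in_alg M) q) x.
Proof.
case=> rs Df _ qf q1; have : map_poly (in_alg M) q %| \prod_(r <- rs) ('X - r%:P).
  by rewrite -(eqp_dvdr _ Df) dvdp_map.
case/dvdp_prod_XsubC=> m Dq; move/eqp_size: (Dq); rewrite size_map_poly.
rewrite size_prod_XsubC; case Dm: (mask m _) => [|x r] sz_q.
  by rewrite sz_q in q1.
by exists x; rewrite (eqp_root Dq) Dm big_cons rootM root_XsubC eqxx.
Qed.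

Lemma prime_prim_root (F : fieldType) p (z : F) :
  prime p -> z ^+ p = 1 -> z != 1 -> p.-primitive_root z.
Proof.
move=> p_pr zp z1; have [m prim_m] := prim_order_exists (prime_gt0 p_pr) zp.
case/primeP: p_pr => _ p_div /p_div/pred2P[m1|<- //].
by rewrite -[z]expr1 -m1 (prim_expr_order prim_m) eqxx in z1.
Qed.

Section SplittingTrinomial.

Variables (p : nat) (b c : rat).
Hypotheses (p_pr : prime p) (irr_h : irreducible_poly (h_poly p b c)).
Variables (M : splittingFieldType rat) (a : M).
Hypothesis ha0 : root (map_poly (in_alg M) (h_poly p b c)) a.

(* The [2 p] roots of [h] are distinct, so one of them is neither [a] nor [c / a];
   its quotient by one of these two is a nontrivial root of unity. *)
Lemma trinomial_prim_root (f : {poly rat}) :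
    splittingFieldFor 1 (map_poly (in_alg M) f) {:M} -> h_poly p b c %| f ->
  exists z : M, p.-primitive_root z.
Proof.
case=> rs0 Df _ hf.
have [rs Drs] : exists rs,
    map_poly (in_alg M) (h_poly p b c) %= \prod_(r <- rs) ('X - r%:P).
  have : map_poly (in_alg M) (h_poly p b c) %| \prod_(r <- rs0) ('X - r%:P).
    by rewrite -(eqp_dvdr _ Df) dvdp_map.
  by case/dvdp_prod_XsubC=> m Dq; exists (mask m rs0).
have [mon_h sz_h] := h_poly_monic_size b c p_pr.
have uniq_rs : uniq rs.
  rewrite -separable_prod_XsubC -(eqp_separable Drs).
  rewrite -(irreducible_minPoly irr_h mon_h ha0).
  by apply: pcharf0_separable => n; rewrite pchar_lalg pchar_num.
have /allPn[x rs_x] : ~~ all [in [:: a; conj_root c a]] rs.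
  apply/negP=> /allP/(uniq_leq_size uniq_rs) /=.
  have /eqP := eqp_size Drs; rewrite size_prod_XsubC size_map_poly sz_h eqSS => /eqP<-.
  by have := prime_gt1 p_pr; lia.
rewrite !inE negb_or => /andP[xa xa'].
have hx : root (map_poly (in_alg M) (h_poly p b c)) x.
  by rewrite (eqp_root Drs) root_prod_XsubC.
have a0 := root_neq0 p_pr irr_h ha0; have a'0 := conj_root_neq0 p_pr irr_h ha0.
case: (trinomial_rootX p_pr irr_h ha0 hx) => xp.
  exists (x / a); apply: prime_prim_root => //.
    by rewrite expr_div_n xp divff ?expf_neq0.
  by apply: contra xa => /eqP xa1; rewrite -[x](divfK a0) xa1 mul1r.
exists (x / conj_root c a); apply: prime_prim_root => //.
  by rewrite expr_div_n xp divff ?expf_neq0.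
by apply: contra xa' => /eqP xa1; rewrite -[x](divfK a'0) xa1 mul1r.
Qed.

Lemma splitting_trinomial_full (z : M) : p.-primitive_root z ->
    splittingFieldFor 1 (map_poly (in_alg M) (h_poly p b c)) {:M} ->
  <<<<1; z>>; a>>%AS = fullv :> {vspace M}.
Proof.
move=> prim_z [rs Drs genM]; apply/eqP; rewrite eqEsubv subvf -genM /=.
apply/Fadjoin_seqP; split; first exact: sub1v.
move=> r rs_r; have : root (map_poly (in_alg M) (h_poly p b c)) r.
  by rewrite (eqp_root Drs) root_prod_XsubC.
case/(trinomial_roots p_pr irr_h ha0 prim_z) => i [] ->.
  by rewrite rpredM ?rpredX ?prim_root_mem_split ?root_mem_split.
by rewrite rpredM ?rpredX ?prim_root_mem_split ?conj_root_mem_split.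
Qed.

End SplittingTrinomial.

(** * Passing to arbitrary splitting fields of [h] and [d_h] *)

Section DicksonGalois.

Variables (p : nat) (b c : rat).
Hypotheses (p_pr : prime p) (irr_h : irreducible_poly (h_poly p b c)).

Lemma galois_group_h_poly (gT : finGroupType) (H : {group gT}) :
    (forall (M : splittingFieldType rat) (a z : M),
       root (map_poly (in_alg M) (h_poly p b c)) a -> p.-primitive_root z ->
       <<<<1; z>>; a>>%AS = fullv :> {vspace M} -> 'Gal({:M} / 1) \isog H) ->
  galois_group_isog (h_poly p b c) H.
Proof.
move=> HM M splM; have [a ha0] := splitting_root splM (dvdpp _) irr_h.1.
have [z prim_z] := trinomial_prim_root p_pr irr_h ha0 splM (dvdpp _).
by apply: (HM M a z) => //; apply: (splitting_trinomial_full p_pr irr_h ha0).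
Qed.

(* A splitting field [L = Q(x)] of [d] need not contain the roots of [h], so it
   is embedded in a splitting field [M] of the product of [h] and the minimal
   polynomial of [x]. *)
Lemma galois_group_d_poly (H : {group {perm 'F_p}}) :
    (forall (M : splittingFieldType rat) (a z : M),
       root (map_poly (in_alg M) (h_poly p b c)) a -> p.-primitive_root z ->
       galois_acts_as (@dickson_root p c M a z) H) ->
  galois_group_isog (d_poly p b c) H.
Proof.
move=> HM L [rs Drs genL].
pose x := separable_generator 1 {:L}%AS.
have genx : <<1; x>>%VS = {:L}%VS.
  have /and3P[_ sepL _] := galois_rat (1%AS : {subfield L}).
  by rewrite -eq_adjoin_separable_generator ?sub1v.
have [m [irr_m mon_m Dm]] := minPoly_irreducible x.
have [mon_h _] := h_poly_monic_size b c p_pr.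
have [|M splM] := @rat_splitting_field_exists (h_poly p b c * m).
  by rewrite mulf_neq0 ?monic_neq0.
have [a ha0] := splitting_root splM (dvdp_mulr _ (dvdpp _)) irr_h.1.
have [y my0] := splitting_root splM (dvdp_mull _ (dvdpp _)) irr_m.1.
have [z prim_z] := trinomial_prim_root p_pr irr_h ha0 splM (dvdp_mulr _ (dvdpp _)).
have [g gx] := number_field_embedding genx Dm my0.
have gA (q : {poly rat}) : map_poly g (map_poly (in_alg L) q) = map_poly (in_alg M) q.
  rewrite -map_poly_comp; apply: eq_map_poly => r /=.
  by rewrite !alg_num_field fmorph_rat.
have gH (q : {poly rat}) w :
    g (map_poly (in_alg L) q).[w] = (map_poly (in_alg M) q).[g w].
  by rewrite -horner_map gA.
have gprod (r : seq L) :
    map_poly g (\prod_(w <- r) ('X - w%:P)) = \prod_(w <- map g r) ('X - w%:P).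
  rewrite rmorph_prod big_map; apply: eq_bigr => w _.
  by rewrite rmorphB /= map_polyX map_polyC.
have mx0 : root (map_poly (in_alg L) m) x by rewrite -Dm root_minPoly.
pose T := @dickson_root p c M a z.
have injT : injective T := dickson_root_inj p_pr irr_h ha0 prim_z.
have rootsT w : root (map_poly (in_alg M) (d_poly p b c)) w -> exists j, w = T j.
  rewrite (d_poly_factor p_pr irr_h ha0 prim_z) -(big_map T predT (fun w => 'X - w%:P)).
  by rewrite root_prod_XsubC => /mapP[j _ ->]; exists j.
have DrsM : map_poly (in_alg M) (d_poly p b c) %= \prod_(w <- map g rs) ('X - w%:P).
  by rewrite -gprod -gA eqp_map.
(* [u] indexes the roots of [d_h] in [L] so that [g] carries [u j] to [T j]. *)
have /fin_all_exists[u Du] j : exists r, g r = T j.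
  have := root_dickson_root p_pr irr_h ha0 prim_z j; rewrite -/T.
  by rewrite (eqp_root DrsM) root_prod_XsubC => /mapP[r _ ->]; exists r.
have inju : injective u by move=> i j uij; apply: injT; rewrite -!Du uij.
have rs_u r : r \in rs -> exists j, r = u j.
  move=> rs_r; have [|j gr] := rootsT (g r).
    by rewrite (eqp_root DrsM) root_prod_XsubC map_f.
  by exists j; apply: (fmorph_inj g); rewrite gr Du.
(* Since [x] generates [L], compatibility of [s] and [t] at [x] gives it everywhere. *)
have intertwine (s : gal_of {:M}) (t : gal_of {:L}) :
    s y = g (t x) -> forall w, s (g w) = g (t w).
  move=> sy w; have [q ->] := adjoin_full_horner w genx.
  by rewrite gal_horner_rat !gH gx gal_horner_rat sy.
have [HM1 HM2] := HM M a z ha0 prim_z.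
have actL (t : gal_of {:L}) : t \in 'Gal({:L} / 1) ->
    exists2 v, v \in H & forall j, u (v j) = t (u j).
  (* Extension of [t] to [M]: [g (t x)] is a conjugate of [y]. *)
  move=> Gt; have mtx : root (map_poly (in_alg M) m) (g (t x)).
    by rewrite -gA fmorph_root; apply: gal_root_rat.
  have [s Gs sy] := gal_conj_root irr_m my0 mtx; have [v Hv Tv] := HM1 s Gs.
  exists v => // j; apply: (fmorph_inj g).
  by rewrite -(intertwine s t sy) !Du; apply: Tv.
have actM v : v \in H -> exists2 t, t \in 'Gal({:L} / 1) &
    forall j, u (v j) = t (u j).
  move=> Hv; have [s Gs Tv] := HM2 v Hv.
  have [r Dr] := splitting_field_normal 1%AS x.
  (* Restriction of [s] to [L]: by normality the minimal polynomial of [x] splits in [L], so [s y]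
     stays in the image of [g]. *)
  have [w gw] : exists w, s y = g w.
    have := gal_root_rat s my0; rewrite -gA -Dm (eqP Dr) gprod root_prod_XsubC.
    by case/mapP=> w _ ->; exists w.
  have mw0 : root (map_poly (in_alg L) m) w.
    by rewrite -(fmorph_root g) gA -gw; apply: gal_root_rat.
  have [t Gt tx] := gal_conj_root irr_m mx0 mw0; exists t => // j.
  by apply: (fmorph_inj g); rewrite -(intertwine s t) ?tx // !Du; apply: Tv.
have permE (t : gal_of {:L}) (v : {perm 'F_p}) :
    (forall j, u (v j) = t (u j)) -> gal_perm u t = v.
  exact: gal_permE.
have onto v : v \in H -> exists2 t, t \in 'Gal({:L} / 1) & gal_perm u t = v.
  by move=> /actM[t Gt Dt]; exists t => //; apply: permE.
have [] // := @gal_onto_by_dim L {:L}%AS _ H (gal_perm u).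
- move=> s t /actL[v _ Dv] /actL[w _ Dw].
  rewrite (permE s v Dv) (permE t w Dw); apply: permE => j.
  by rewrite permM Dw Dv galM ?memvf.
- by move=> s /actL[v Hv Dv]; rewrite (permE s v Dv).
- move=> s /actL[v Hv Dv]; rewrite (permE s v Dv) => v1.
  (* A trivial permutation fixes all the roots of [d_h], and these generate [L]. *)
  have subK : (<<1 & rs>> <= fixedField [set s])%VS.
    apply/Fadjoin_seqP; split; first exact: sub1v.
    move=> r /rs_u[j ->]; apply/fixedFieldP; rewrite ?memvf // => t /set1P->.
    by rewrite -Dv v1 perm1.
  move=> w _; have /(subvP subK)/mem_fixedFieldP[_] : w \in <<1 & rs>>%VS.
    by rewrite genL memvf.
  by apply; apply: set11.
(* The order bound comes from surjectivity onto [H], already known through [actM]. *)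
- have -> : \dim {:L}%AS = #|'Gal({:L} / 1)|.
    by rewrite -galois_dim ?galois_rat // dimv1 divn1.
  apply: leq_trans (leq_imset_card (gal_perm u) _).
  by apply/subset_leq_card/subsetP=> v /onto[t Gt <-]; apply: imset_f.
by move=> _; apply.
Qed.

End DicksonGalois.

(** * The case distinction on the square class of [b^2 - 4 c^p] *)

Theorem theorem1p2 (p : nat) (b c : rat) :
  prime p -> (3 < p)%N -> irreducible_poly (h_poly p b c) ->
  [/\ irreducible_poly (d_poly p b c),
      ~ in_rat_sq_class ((-1) ^+ ((p * p.-1) %/ 2) * p%:R) (b ^+ 2 - 4%:R * c ^+ p) ->
        [/\ galois_group_isog (d_poly p b c) (Aff_group p),
            is_cyclic_sdprod (Aff_group p) p p.-1
          & galois_group_isog (h_poly p b c)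
              (setX_group (Aff_group p) [set: 'Z_2]%G)],
      p = 1 %[mod 4] ->
      in_rat_sq_class p%:R (b ^+ 2 - 4%:R * c ^+ p) ->
        galois_group_isog (d_poly p b c) (Aff_group p) /\
        galois_group_isog (h_poly p b c) (Aff_group p)
    & p = 3 %[mod 4] ->
      in_rat_sq_class (- p%:R) (b ^+ 2 - 4%:R * c ^+ p) ->
        [/\ galois_group_isog (d_poly p b c) (AffSq_group p),
            is_cyclic_sdprod (AffSq_group p) p ((p.-1) %/ 2),
            (AffSq p <| Aff p)%g /\ #|Aff p : AffSq p|%g = 2%N
          & galois_group_isog (h_poly p b c)
              (setX_group (AffSq_group p) [set: 'Z_2]%G)]].
Proof.
move=> p_pr p_gt3 irr_h.
have p_odd : odd p by case: (even_prime p_pr) p_gt3 => // ->.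
(* Whether [delta] lies in [Q(z)] depends on [b], [c] and [p] only, so the same case applies in
   every field [M]. *)
have mem_delta (M : splittingFieldType rat) (a z : M) :
    root (map_poly (in_alg M) (h_poly p b c)) a -> p.-primitive_root z ->
    sqrt_disc p c a \in <<1; z>>%VS <->
    in_rat_sq_class ((-1) ^+ p./2 * p%:R) (b ^+ 2 - 4%:R * c ^+ p).
  move=> ha0 prim_z; apply: (mem_cyclotomic_quadratic p_pr p_odd prim_z).
    exact: (sqrt_discK p_pr irr_h ha0).
  by move=> q; apply: (sqrt_disc_irrational p_pr irr_h ha0).
split.
- have [M splM] := @rat_splitting_field_exists (h_poly p b c)
    (monic_neq0 (h_poly_monic_size b c p_pr).1).
  have [a ha0] := splitting_root splM (dvdpp _) irr_h.1.
  have [z prim_z] := trinomial_prim_root p_pr irr_h ha0 splM (dvdpp _).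
  exact: (irreducible_d_poly p_pr irr_h ha0 prim_z).
(* As [p] is odd, the signs with exponents [p (p - 1) / 2] and [p./2] agree. *)
- have -> : (p * p.-1 %/ 2 = p * p./2)%N by nia.
  rewrite exprM -signr_odd p_odd expr1 => ndelta.
  have nmem (M : splittingFieldType rat) (a z : M) :
      root (map_poly (in_alg M) (h_poly p b c)) a -> p.-primitive_root z ->
      sqrt_disc p c a \notin <<1; z>>%VS.
    by move=> ha0 prim_z; apply/negP=> /(mem_delta M a z ha0 prim_z).
  split; last first.
  + apply: galois_group_h_poly => // M a z ha0 prim_z.
    by case: (gal_generic p_pr p_odd irr_h ha0 prim_z (nmem _ _ _ ha0 prim_z)).
  + exact: Aff_sdprod.
  apply: galois_group_d_poly => // M a z ha0 prim_z.
  by case: (gal_generic p_pr p_odd irr_h ha0 prim_z (nmem _ _ _ ha0 prim_z)).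
- move=> p1 sq_delta.
  have mem (M : splittingFieldType rat) (a z : M) :
      root (map_poly (in_alg M) (h_poly p b c)) a -> p.-primitive_root z ->
      sqrt_disc p c a \in <<1; z>>%VS.
    move=> ha0 prim_z; apply/(mem_delta M a z ha0 prim_z).
    by rewrite -signr_odd (_ : odd p./2 = false) ?expr0 ?mul1r //; lia.
  split.
    apply: galois_group_d_poly => // M a z ha0 prim_z.
    by case: (gal_1mod4 p_pr p_odd irr_h ha0 prim_z (mem _ _ _ ha0 prim_z) p1).
  apply: galois_group_h_poly => // M a z ha0 prim_z.
  by case: (gal_1mod4 p_pr p_odd irr_h ha0 prim_z (mem _ _ _ ha0 prim_z) p1).
- move=> p3 sq_delta.
  have mem (M : splittingFieldType rat) (a z : M) :
      root (map_poly (in_alg M) (h_poly p b c)) a -> p.-primitive_root z ->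
      sqrt_disc p c a \in <<1; z>>%VS.
    move=> ha0 prim_z; apply/(mem_delta M a z ha0 prim_z).
    by rewrite -signr_odd (_ : odd p./2 = true) ?expr1 ?mulN1r //; lia.
  split; [|exact: AffSq_sdprod|exact: AffSq_normal_index2|].
    apply: galois_group_d_poly => // M a z ha0 prim_z.
    by case: (gal_3mod4 p_pr p_odd irr_h ha0 prim_z (mem _ _ _ ha0 prim_z) p3).
  apply: galois_group_h_poly => // M a z ha0 prim_z.
  by case: (gal_3mod4 p_pr p_odd irr_h ha0 prim_z (mem _ _ _ ha0 prim_z) p3).
Qed.
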